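(* Let $G$ be a clique-sum of odd cycles and bipartite graphs (with at least one odd cycle), and let $I(G)$ denote its edge ideal. Let $2n+1$ be the smallest size of an odd cycle in $G$. (1) Then $\displaystyle\rho_a(I(G))=\frac{2n+2}{2n+1}$. (2) Suppose that all odd cycles in $G$ are of the same size, and let $k$ be the maximum number of odd cycles in $G$ which are pairwise at distance two or higher. If $k\ge2$, then $\displaystyle\rho(I(G))=\frac{kn+k}{kn+1}$.
   Context: All graphs are finite and simple, with no isolated vertices. If $G_1,G_2$ are graphs such that $G_1\cap G_2=K_r$ is a complete graph (on $r\ge 1$ vertices), with $G_1\neq K_r$ and $G_2\ne K_r$, then $G_1\cup G_2$ is called the clique-sum of $G_1$ and $G_2$ along $K_r$; a clique-sum of a finite collection of graphs is a graph obtained from them by repeatedly taking clique-sums. For subgraphs $H,H'$ of $G$, the distance $d(H,H')$ is the minimum of $d(u,v)$ over $u\in V(H)$, $v\in V(H')$, where $d(u,v)$ is the length of a shortest path in $G$ from $u$ to $v$. The edge ideal $I(G)$, over a field $\mathbb{K}$, is the ideal of $\mathbb{K}[x : x\in V(G)]$ generated by $\{xy : \{x,y\}\in E(G)\}$. For an ideal $I$ in a Noetherian ring $R$, $I^{(s)}=\bigcap_{P\in\mathrm{Ass}(I)}(I^sR_P\cap R)$ is the $s$-th symbolic power. The resurgence and asymptotic resurgence are $\rho(I)=\sup\{s/t : s,t\in\mathbb{N},\ I^{(s)}\not\subset I^t\}$ and $\rho_a(I)=\sup\{s/t : s,t\in\mathbb{N},\ I^{(sr)}\not\subset I^{tr}\text{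 for all } r\gg0\}$, where $\mathbb{N}$ denotes the positive integers. *)

(* Defs.v *)
From HB Require Import structures.
From mathcomp Require Import all_boot all_order all_algebra.
(* The notations of mpoly clash with those of MathComp-Analysis. *)
From mathcomp Require Import -(notations) mpoly.
From mathcomp Require Import all_classical all_reals all_analysis.

Set Implicit Arguments.
Unset Strict Implicit.
Unset Printing Implicit Defensive.

Import Order.TTheory GRing.Theory Num.Theory.

Local Open Scope classical_set_scope.
Local Open Scope ring_scope.

(* Graphs carry their own vertex set, a subset of an ambient finite type, so
   that unions, intersections and subgraphs can be taken literally. *)
Record graph (T : finType) := Graph {
  vertices : {set T};
  edges : {set {set T}} }.

Section Graphs.
Variable T : finType.
Implicit Types G H : graph T.
Local Open Scope set_scope.

Definition simple_graph G : Prop :=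
  forall e, e \in edges G -> e \subset vertices G /\ #|e| = 2%N.

Definition adj G : rel T := fun x y => [set x; y] \in edges G.

Definition no_isolated_vertex G : Prop :=
  forall x, x \in vertices G -> exists y, adj G x y.

Definition subgraph H G : Prop :=
  vertices H \subset vertices G /\ edges H \subset edges G.

Definition graph_union G H : graph T :=
  Graph (vertices G :|: vertices H) (edges G :|: edges H).

Definition graph_inter G H : graph T :=
  Graph (vertices G :&: vertices H) (edges G :&: edges H).

Definition complete_graph (W : {set T}) : graph T :=
  Graph W [set e : {set T} | (e \subset W) && (#|e| == 2%N)].

Definition is_cycle G : Prop :=
  exists c : seq T,
    [/\ uniq c, (2 < size c)%N &
        G = Graph [set x in c] [set [set x; next c x] | x in c]].

Definition odd_cycle G : Prop := is_cycle G /\ odd #|vertices G|.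

Definition bipartite G : Prop :=
  exists A B : {set T},
    [/\ A :|: B = vertices G, A :&: B = finset.set0 &
        forall x y, adj G x y -> (x \in A) && (y \in B) || (y \in A) && (x \in B)].

Inductive clique_sum (P : graph T -> Prop) : graph T -> Prop :=
| clique_sum_base G : P G -> clique_sum P G
| clique_sum_step G1 G2 (W : {set T}) :
    clique_sum P G1 -> clique_sum P G2 -> W != finset.set0 ->
    graph_inter G1 G2 = complete_graph W ->
    G1 <> complete_graph W -> G2 <> complete_graph W ->
    clique_sum P (graph_union G1 G2).

Definition odd_cycle_or_bipartite G : Prop :=
  [/\ simple_graph G, no_isolated_vertex G & odd_cycle G \/ bipartite G].

Definition odd_cycle_in G H : Prop := subgraph H G /\ odd_cycle H.

Definition smallest_odd_cycle_size G (m : nat) : Prop :=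
  (exists2 H, odd_cycle_in G H & #|vertices H| = m) /\
  (forall H, odd_cycle_in G H -> (m <= #|vertices H|)%N).

End Graphs.

Section Distance.
Variables (R : realType) (T : finType).
Implicit Types G H : graph T.

(* The distance is +oo when no path exists. *)
Definition dist G (u v : T) : \bar R :=
  ereal_inf [set (size p)%:R%:E | p in
    [set p : seq T | [/\ path (adj G) u p, uniq (u :: p) & last u p = v]]].

Definition subgraph_dist G H1 H2 : \bar R :=
  ereal_inf [set dist G uv.1 uv.2 | uv in
    [set uv : T * T | uv.1 \in vertices H1 /\ uv.2 \in vertices H2]].

Definition distant_odd_cycles G k (C : 'I_k -> graph T) : Prop :=
  (forall i, odd_cycle_in G (C i)) /\
  (forall i j, i != j -> (2%:R%:E <= subgraph_dist G (C i) (C j))%E).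

(* Cycles at distance at least two are distinct, so the length of a family
   is the number of its members. *)
Definition max_distant_odd_cycles G (k : nat) : Prop :=
  (exists C : 'I_k -> graph T, distant_odd_cycles G C) /\
  (forall m (C : 'I_m -> graph T), distant_odd_cycles G C -> (m <= k)%N).

End Distance.

Section Ideals.
Variable A : idomainType.
Implicit Types I J P : set A.

Definition ideal I : Prop :=
  [/\ I 0, forall x y, I x -> I y -> I (x + y) & forall a x, I x -> I (a * x)].

Definition ideal_gen (S : set A) : set A := smallest ideal S.

Definition ideal_mul I J : set A :=
  ideal_gen [set z | exists x y, [/\ I x, J y & z = x * y]].

Fixpoint ideal_pow I (s : nat) : set A :=
  if s is s'.+1 then ideal_mul I (ideal_pow I s') else setT.

Definition prime_ideal P : Prop :=
  [/\ ideal P, ~ P 1 & forall x y, P (x * y) -> P x \/ P y].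

Definition associated_prime I P : Prop :=
  prime_ideal P /\ exists f, P = [set a | I (a * f)].

(* As [A] is a domain, the localisation at P is a subring of Frac(A), and
   every element of the extended ideal is a single fraction x / u. *)
Definition localized_ideal J P : set {fraction A} :=
  [set z | exists x u, [/\ J x, ~ P u & z = tofrac x / tofrac u]].

Definition symbolic_pow I (s : nat) : set A :=
  \bigcap_(P in associated_prime I)
    (@tofrac A @^-1` localized_ideal (ideal_pow I s) P).

End Ideals.

Section Resurgence.
Variables (R : realType) (A : idomainType).

Definition resurgence (I : set A) : \bar R :=
  ereal_sup [set x | exists s t : nat,
    [/\ (0 < s)%N, (0 < t)%N, ~ (symbolic_pow I s `<=` ideal_pow I t) &
        x = (s%:R / t%:R)%:E]].

Definition asymptotic_resurgence (I : set A) : \bar R :=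
  ereal_sup [set x | exists s t : nat,
    [/\ (0 < s)%N, (0 < t)%N,
        \forall r \near \oo,
          ~ (symbolic_pow I (s * r)%N `<=` ideal_pow I (t * r)%N) &
        x = (s%:R / t%:R)%:E]].

End Resurgence.

(* The variable attached to the vertex x is the one of index [enum_rank x]. *)
Definition vertex_var (K : fieldType) (V : finType) (x : V) :
    mpoly #|V| K :=
  mpolyX K (mnm1 (enum_rank x)).

Definition edge_ideal (K : fieldType) (V : finType) (G : graph V) :
    set (mpoly #|V| K) :=
  ideal_gen [set f | exists x y, adj G x y /\ f = vertex_var K x * vertex_var K y].

Arguments edge_ideal K {V} G.

(* Main.v *)
Require Import Defs.
From mathcomp Require Import all_boot all_order all_algebra.
From mathcomp Require Import -(notations) mpoly.
From mathcomp Require Import all_classical all_reals all_analysis.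
From mathcomp Require Import zify.

Set Implicit Arguments.
Unset Strict Implicit.
Unset Printing Implicit Defensive.

Local Open Scope ring_scope.

(** A monomial in the variables x_v is a weight a : V -> nat on the vertices,
    and both kinds of powers of the edge ideal I are spanned by monomials that
    a condition on a describes.
    - x^a lies in I^t exactly when t edges, repetitions allowed, can be packed
      under a ([edge_ideal_powE]).
    - x^a lies in I^(s) exactly when every vertex cover has weight at least s
      under a ([symbolic_pow_weight], [symbolic_pow_monomial]): the associated
      primes of I are generated by the variables of the minimal vertex covers,
      and locally at such a prime I is the prime itself.

    The combinatorial heart is a min-max theorem for clique-sums of odd cycles
    and bipartite graphs ([clique_sum_packable]): the least weight of a vertex
    cover is the greatest value of a packing under a of edges, worth 1 each,
    and of odd cycles, worth m + 1 when they have 2m + 1 vertices.  For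
    bipartite graphs this is the weighted form of Koenig's theorem, for an odd
    cycle it follows by peeling off edges until the weight is constant, and a
    clique-sum inherits it because a weight splits into one weight on each
    side without changing the least weight of a cover.

    It remains to trade the odd cycles of a packing for edges.  An odd cycle
    minus any of its vertices is perfectly matched, so two odd cycles X and Y
    that meet or are joined by an edge contain (|X| + |Y|) / 2 edges, which is
    the best that their number of vertices allows.  Pairing greedily, all the
    loss is half an edge for each cycle that stays single, and these are
    pairwise at distance at least two ([odd_cycles_matching]).

    For the asymptotic resurgence the number of single cycles is bounded by
    |V|, hence negligible, and what is left is the ratio (m + 1) / (m + 1/2)
    between the value of a cycle and half of its size, which is largest for
    the smallest cycles, m = n; large powers of the monomial of a smallest
    cycle attain this ratio in the limit.  For the resurgence there are at
    most k single cycles, and the worst case is the product of the monomials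
    of k distant cycles: it lies in I^(kn+k), but no edge joins two of the
    cycles, so that only kn edges can be packed. *)

(** * Weighted vertex covers and packings *)

Section Weights.
(* Makes the lemmas on finite sets prevail over those on classical sets that
   have the same names. *)
Import mathcomp.boot.fintype mathcomp.boot.finset.
Local Open Scope set_scope.
Local Open Scope nat_scope.
Variable V : finType.
Implicit Types (G H : graph V) (a : V -> nat) (x y u v : V).
Implicit Types (C D X Y : {set V}) (L M : seq {set V}).

Definition vertex_cover G C : bool :=
  [forall x, forall y, adj G x y ==> (x \in C) || (y \in C)].

Definition weight a C : nat := \sum_(v in C) a v.

Definition load L v : nat := \sum_(X <- L) (v \in X).

(** Packings only use the vertices of an odd cycle, and sets of vertices have
    a decidable equality, which graphs lack. *)
Definition odd_cycle_set G X : Prop :=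
  exists2 H, odd_cycle_in G H & vertices H = X.

Definition block G X : Prop := X \in edges G \/ odd_cycle_set G X.

(** An edge is worth 1 and an odd cycle on 2m + 1 vertices is worth m + 1: this
    is the number of vertices that a cover must spend on it. *)
Definition value L : nat := \sum_(X <- L) uphalf #|X|.

(** The min-max equality for a: the weight of a cover always bounds the value of
    a packing from above, so C is optimal and L too. *)
Definition packable G a : Prop := exists C L,
  [/\ vertex_cover G C, forall X, X \in L -> block G X,
      forall v, load L v <= a v & weight a C <= value L].

Lemma vertex_coverP G C :
  reflect (forall x y, adj G x y -> (x \in C) || (y \in C)) (vertex_cover G C).
Proof.
apply: (iffP forallP) => [h x y xy | h x].
  by have /forallP/(_ y)/implyP := h x; apply.
by apply/forallP => y; apply/implyP; apply: h.
Qed.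

Lemma adjC G x y : adj G x y = adj G y x.
Proof. by rewrite /adj setUC. Qed.

Lemma adj_neq G x y : simple_graph G -> adj G x y -> x != y.
Proof. by move=> sG /sG[_]; rewrite cards2; case: eqP. Qed.

Lemma weightE a C : weight a C = \sum_v (v \in C) * a v.
Proof.
rewrite /weight big_mkcond; apply: eq_bigr => v _.
by case: (v \in C); rewrite ?mul1n.
Qed.

Lemma weightS a C D : C \subset D -> weight a C <= weight a D.
Proof.
move/subsetP=> CD; rewrite !weightE; apply: leq_sum => v _.
by case: (boolP (v \in C)) => // /CD ->.
Qed.

Lemma weightU1 a C x : x \notin C -> weight a (x |: C) = a x + weight a C.
Proof. exact: big_setU1. Qed.

Lemma weightD1 a C x : x \in C -> weight a C = a x + weight a (C :\ x).
Proof. exact: big_setD1. Qed.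

Lemma vertex_coverT G : vertex_cover G [set: V].
Proof. by apply/vertex_coverP => x y _; rewrite inE. Qed.

Lemma vertex_coverS G C D : C \subset D -> vertex_cover G C -> vertex_cover G D.
Proof.
move=> /subsetP CD /vertex_coverP cC; apply/vertex_coverP => x y /cC.
by case/orP=> /CD ->; rewrite ?orbT.
Qed.

Lemma vertex_coverC1 G x : simple_graph G -> vertex_cover G [set~ x].
Proof.
move=> sG; apply/vertex_coverP => u v uv; rewrite !inE.
by have := adj_neq sG uv; case: (eqVneq u x) => //= ->; rewrite eq_sym.
Qed.

Lemma adj_covered G C x y :
  vertex_cover G C -> adj G x y -> x \notin C -> y \in C.
Proof. by move=> /vertex_coverP cC /cC /orP[-> //|]. Qed.

Lemma vertex_cover_edge G C (e : {set V}) :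
  simple_graph G -> vertex_cover G C -> e \in edges G -> 0 < #|e :&: C|.
Proof.
move=> sG cC eG; have [_ /eqP/cards2P[x [y [_ ee]]]] := sG _ eG.
rewrite card_gt0; apply/set0Pn.
have /orP[xC|yC] : (x \in C) || (y \in C).
  by apply: (vertex_coverP _ _ cC); rewrite /adj -ee.
  by exists x; rewrite ee !inE eqxx xC.
by exists y; rewrite ee !inE eqxx yC orbT.
Qed.

(** A vertex can leave a cover when its neighbours enter it.  All the
    optimality arguments below rest on exchanges of this form. *)
Lemma vertex_cover_swap G C D x :
  simple_graph G -> vertex_cover G C ->
  (forall y, adj G x y -> y \in C :|: D) ->
  vertex_cover G (C :\ x :|: D).
Proof.
move=> sG cC nD; apply/vertex_coverP.
suff cov u v : adj G u v -> u \in C ->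
    (u \in C :\ x :|: D) || (v \in C :\ x :|: D).
  move=> u v uv; have /orP[uC|vC] := vertex_coverP _ _ cC _ _ uv.
    exact: cov.
  by rewrite orbC; apply: cov => //; rewrite adjC.
move=> uv uC; rewrite !inE uC andbT; case: (eqVneq u x) => //= ux.
have := nD v; rewrite -ux inE => /(_ uv)/orP[vC|->]; last by rewrite !orbT.
by rewrite vC eq_sym (adj_neq sG uv) /= orbT.
Qed.

Definition decr a X v : nat := a v - (v \in X).

Lemma load_nil v : load [::] v = 0.
Proof. by rewrite /load big_nil. Qed.

Lemma load_cons X L v : load (X :: L) v = (v \in X) + load L v.
Proof. by rewrite /load big_cons. Qed.

Lemma load_cat L M v : load (L ++ M) v = load L v + load M v.
Proof. by rewrite /load big_cat. Qed.

(** The inductive step of the min-max theorem.  If no optimal cover contains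
    both ends of the edge, then removing the edge from a lowers the optimum by
    one only, which is what the edge contributes to the packing. *)
Lemma packable_edge G a x y :
    simple_graph G -> adj G x y -> 0 < a x -> 0 < a y ->
    (forall C, vertex_cover G C -> x \in C -> y \in C ->
       exists2 D, vertex_cover G D & weight a D < weight a C) ->
  packable G (decr a [set x; y]) -> packable G a.
Proof.
move=> sG xy ax ay better [C [L [cC bL lL wC]]].
have xNy := adj_neq sG xy.
have wE : weight a C = weight (decr a [set x; y]) C + ((x \in C) + (y \in C)).
  have -> : (x \in C) + (y \in C) = weight (fun v => v \in [set x; y]) C.
    rewrite weightE (bigD1 x) //= (bigD1 y) 1?eq_sym //= big1 ?addn0.
      by rewrite !inE !eqxx orbT !muln1.
    by move=> v /andP[vx vy]; rewrite !inE (negPf vx) (negPf vy) muln0.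
  rewrite -big_split; apply: eq_bigr => v _ /=; rewrite /decr subnK //.
  by rewrite !inE; case: eqP => [->|_] //=; case: eqP => [->|].
have packL v : load ([set x; y] :: L) v <= a v.
  rewrite load_cons; have := lL v; rewrite /decr.
  suff : (v \in [set x; y]) <= a v by lia.
  by rewrite !inE; case: eqP => [->|_] //=; case: eqP => [->|].
have bxy : block G [set x; y] by left.
have bL' X : X \in [set x; y] :: L -> block G X.
  by rewrite inE => /predU1P[-> //|/bL].
have vL : value ([set x; y] :: L) = (value L).+1.
  by rewrite /value big_cons cards2 xNy.
case: (boolP ((x \in C) && (y \in C))) => [/andP[xC yC]|nxy].
  have [D cD wD] := better C cC xC yC.
  exists D, ([set x; y] :: L); split=> //.
  by rewrite vL; move: wE; rewrite xC yC; lia.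
exists C, ([set x; y] :: L); split=> //; rewrite vL wE.
by move: nxy; case: (x \in C); case: (y \in C) => //= _; lia.
Qed.

(** A vertex whose neighbours have weight zero is irrelevant: covers may
    contain these neighbours instead, at no cost. *)
Lemma packable_drop G a x :
    simple_graph G -> (forall y, adj G x y -> a y = 0) ->
  packable G (fun v => if v == x then 0 else a v) -> packable G a.
Proof.
move=> sG ay [C [L [cC bL lL wC]]].
exists (C :\ x :|: [set y | adj G x y]), L; split=> //.
- by apply: vertex_cover_swap => // y; rewrite !inE => ->; rewrite orbT.
- by move=> v; apply: leq_trans (lL v) _; case: eqP.
apply: leq_trans wC; rewrite !weightE; apply: leq_sum => v _; rewrite !inE.
case: (boolP (adj G x v)) => [/ay -> |_]; first by rewrite muln0.
by rewrite orbF; case: eqP.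
Qed.

Lemma sum_decr a X x : x \in X -> 0 < a x -> \sum_v decr a X v < \sum_v a v.
Proof.
move=> xX ax; rewrite (bigD1 x) // [ltnRHS](bigD1 x) //= /decr xX.
rewrite -addSn leq_add ?leq_sum // => [|v _]; first by lia.
exact: leq_subr.
Qed.

Lemma sum_drop a x : 0 < a x ->
  \sum_v (if v == x then 0 else a v) < \sum_v a v.
Proof.
move=> ax; rewrite (bigD1 x) // [ltnRHS](bigD1 x) //= eqxx.
rewrite -addSn leq_add // leq_sum // => v /negPf->; lia.
Qed.

(** * Bipartite graphs *)

Definition optimal_cover G a C : bool :=
  vertex_cover G C &&
  [forall D, vertex_cover G D ==> (weight a C <= weight a D)].

Lemma optimal_coverP G a C :
  reflect (vertex_cover G C /\
             forall D, vertex_cover G D -> weight a C <= weight a D)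
          (optimal_cover G a C).
Proof.
apply: (iffP andP) => -[cC h]; split=> //.
  by move=> D; move/forallP/(_ D)/implyP: h.
by apply/forallP=> D; apply/implyP/h.
Qed.

Lemma suboptimal_cover G a C :
  vertex_cover G C -> ~~ optimal_cover G a C ->
  exists2 D, vertex_cover G D & weight a D < weight a C.
Proof.
by move=> cC; rewrite /optimal_cover cC /= negb_forall => /existsP[D];
  rewrite negb_imply -ltnNge => /andP[]; exists D.
Qed.

(** The covers of a bipartite graph form a lattice: of two covers, take the
    intersection on one side and the union on the other. *)
Lemma meet_join_cover G (A B : {set V}) C D :
    (forall x y, adj G x y ->
       (x \in A) && (y \in B) || (y \in A) && (x \in B)) ->
    vertex_cover G C -> vertex_cover G D ->
  vertex_cover G (C :&: D :&: A :|: (C :|: D) :&: B).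
Proof.
move=> adjAB cC cD; apply/vertex_coverP.
suff cov u v : adj G u v -> u \in A -> v \in B ->
    (u \in C :&: D :&: A) || (v \in (C :|: D) :&: B).
  move=> u v uv; rewrite 2!in_setU.
  case/orP: (adjAB _ _ uv) => /andP[uA vB].
    by case/orP: (cov _ _ uv uA vB) => ->; rewrite ?orbT.
  by rewrite adjC in uv; case/orP: (cov _ _ uv uA vB) => ->; rewrite ?orbT.
move=> uv uA vB; rewrite !inE uA vB !andbT.
have /orP[->|->] := vertex_coverP _ _ cC _ _ uv; last by rewrite orbT.
by have /orP[->|->] := vertex_coverP _ _ cD _ _ uv; rewrite ?orbT.
Qed.

(** The weighted theorem of Koenig and Egervary.  Fix x of positive weight on
    the side A.  If every neighbour y of positive weight shared an optimal cover
    with x, the lattice operations would produce one optimal cover that contains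
    x and all these neighbours; then x could be removed from it, contradicting
    optimality.  So some edge xy can be peeled off. *)
Lemma bipartite_packable G a : simple_graph G -> bipartite G -> packable G a.
Proof.
move=> sG [A [B [_ dAB adjAB]]].
have [m] := ubnP (\sum_v a v); elim: m => // m IH in a *; rewrite ltnS => sa.
have inA u v : adj G u v -> u \in A -> v \in B.
  move=> /adjAB /orP[/andP[]|/andP[_ uB]] // uA.
  by move: (in_set0 u); rewrite -dAB inE uA uB.
have [x /andP[xA ax]|A0] := pickP (fun x => (x \in A) && (0 < a x)); last first.
  (* A is a cover of weight zero. *)
  exists A, [::]; split=> //.
  - by apply/vertex_coverP => u v /adjAB /orP[] /andP[-> _]; rewrite ?orbT.
  - by move=> v; rewrite load_nil.
  - by rewrite /weight big1 // => v vA; have := A0 v; rewrite vA /=; case: (a v).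
case: (boolP [exists y, [&& adj G x y, 0 < a y &
    ~~ [exists C, [&& optimal_cover G a C, x \in C & y \in C]]]]).
  case/existsP=> y /and3P[xy ay]; rewrite negb_exists => /forallP opt.
  apply: (@packable_edge _ _ x y) => // [C cC xC yC|].
    by apply: suboptimal_cover => //; have := opt C; rewrite xC yC !andbT.
  apply/IH/(leq_trans (sum_decr (X := [set x; y]) (x := x) _ _)) => //.
  by rewrite !inE eqxx.
rewrite negb_exists => /forallP opt.
have [y0 /andP[xy0 ay0]|N0] := pickP (fun y => adj G x y && (0 < a y));
    last first.
  apply: (@packable_drop _ _ x) => // [y xy|].
    by have := N0 y; rewrite xy /=; case: (a y).
  by apply/IH/(leq_trans (sum_drop _)).
have /existsP[C0 /and3P[oC0 xC0 _]] :
    [exists C, [&& optimal_cover G a C, x \in C & y0 \in C]].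
  by have := opt y0; rewrite xy0 ay0 /= negbK.
pose P (C : {set V}) := optimal_cover G a C && (x \in C).
have PC0 : P C0 by rewrite /P oC0.
(* Maximality on the side B makes C absorb every neighbour of x. *)
have [C /andP[oC xC] maxC] := @arg_maxnP _ C0 P (fun C => #|C :&: B|) PC0.
have /optimal_coverP[cC lC] := oC.
have nbr y : adj G x y -> 0 < a y -> y \in C.
  move=> xy ay.
  have /existsP[D /and3P[oD xD yD]] :
      [exists D, [&& optimal_cover G a D, x \in D & y \in D]].
    by have := opt y; rewrite xy ay /= negbK.
  have /optimal_coverP[cD lD] := oD.
  pose I := (C :&: D :&: A) :|: ((C :|: D) :&: B).
  pose J := (C :&: D :&: B) :|: ((C :|: D) :&: A).
  have [cI cJ] : vertex_cover G I /\ vertex_cover G J.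
    split; first exact: (meet_join_cover adjAB).
    apply: meet_join_cover => // u v /adjAB.
    by rewrite orbC andbC [X in _ || X]andbC.
  have wIJ : weight a I + weight a J <= weight a C + weight a D.
    rewrite !weightE -!big_split; apply: leq_sum => v _ /=; rewrite -!mulnDl.
    rewrite leq_mul2r; apply/orP; right; rewrite !inE.
    have : ~~ ((v \in A) && (v \in B)) by rewrite -in_setI dAB inE.
    by case: (v \in A); case: (v \in B); case: (v \in C); case: (v \in D).
  have oI : optimal_cover G a I.
    apply/optimal_coverP; split=> // E cE.
    by rewrite -(leq_add2r (weight a J)) (leq_trans wIJ) // leq_add ?lC ?lD.
  have xI : x \in I by rewrite !inE xC xD xA.
  have CB : C :&: B \subset I :&: B.
    by apply/subsetP => u; rewrite !inE => /andP[-> ->]; rewrite !orbT.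
  have /eqP CIB : C :&: B == I :&: B.
    by rewrite eqEcard CB; apply: maxC; rewrite /P oI xI.
  have : y \in I :&: B by rewrite !inE yD (inA x y) // !orbT.
  by rewrite -CIB !inE => /andP[].
have cS : vertex_cover G (C :\ x :|: [set y | adj G x y]).
  by apply: vertex_cover_swap => // y; rewrite !inE => ->; rewrite orbT.
have := lC _ cS; rewrite leqNgt => /negP[].
rewrite (weightE a C) (bigD1 x) //= xC mul1n weightE (bigD1 x) //=.
rewrite !inE eqxx (_ : adj G x x = false); last first.
  by apply/negP => /(adj_neq sG)/eqP.
rewrite mul0n add0n -add1n leq_add ?leq_sum // => v vx.
rewrite !inE vx /=; case: (boolP (adj G x v)) => [xv|]; last by rewrite orbF.
by case: (posnP (a v)) => [->|av]; rewrite ?muln0 // (nbr v).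
Qed.

(** * Odd cycles *)

Lemma lighter_cover G a C x y :
    simple_graph G -> vertex_cover G C -> x \in C -> a y < a x ->
    (forall z, adj G x z -> z \in y |: C) ->
  exists2 D, vertex_cover G D & weight a D < weight a C.
Proof.
move=> sG cC xC yx nx; exists (C :\ x :|: [set y]).
  by apply: vertex_cover_swap => // z /nx; rewrite setUC.
rewrite setUC (weightD1 a xC); case: (boolP (y \in C :\ x)) => yC.
  rewrite (setUidPr _) ?sub1set //; move: yx; case: (a x) => // k _.
  by rewrite addSn ltnS leq_addl.
by rewrite weightU1 // ltn_add2r.
Qed.

(** If x outweighs one neighbour y, no optimal cover contains both x and its
    other neighbour u, since x could be exchanged for y.  So ux can be peeled
    off, unless u has weight zero; then the same reasoning applies to xy, unless
    y has weight zero as well and x can be dropped. *)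
Lemma packable_degree2 G a x y u :
    simple_graph G -> adj G x y -> adj G x u ->
    (forall z, adj G x z -> z = y \/ z = u) -> a y < a x ->
    (forall b, \sum_v b v < \sum_v a v -> packable G b) ->
  packable G a.
Proof.
move=> sG xy xu nx yx IH; have ax : 0 < a x by case: (a x) yx.
have drop_x z : \sum_v decr a [set x; z] v < \sum_v a v.
  by apply: (sum_decr (x := x)); rewrite ?inE ?eqxx.
have [au0|au] := posnP (a u).
  have [ay0|ay] := posnP (a y).
    by apply: (packable_drop (x := x)) => // [z /nx[]->//|]; apply/IH/sum_drop.
  apply: (packable_edge sG xy) => // [C cC xC yC|]; last exact: IH.
  by apply: (lighter_cover (x := x) (y := u)); rewrite ?au0 // => z /nx[]->;
    rewrite !inE ?yC ?eqxx ?orbT.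
apply: (packable_edge sG xu) => // [C cC xC uC|]; last exact: IH.
by apply: (lighter_cover (x := x) (y := y)) => // z /nx[]->;
  rewrite !inE ?uC ?eqxx ?orbT.
Qed.

Definition cycle_graph (c : seq V) : graph V :=
  Graph [set x in c] [set [set x; next c x] | x in c].

Lemma cycle_graph_adj (c : seq V) x :
  x \in c -> adj (cycle_graph c) x (next c x).
Proof. by move=> xc; apply/imsetP; exists x. Qed.

Lemma adj_cycle_graph (c : seq V) x z : uniq c ->
  adj (cycle_graph c) x z -> x \in c /\ (z = next c x \/ z = prev c x).
Proof.
move=> uc /imsetP[w wc] /setP e.
have [xw zw wxz] : [/\ x \in [set w; next c w],
    z \in [set w; next c w] & w \in [set x; z]].
  by split; [rewrite -e | rewrite -e | rewrite e]; rewrite !inE eqxx ?orbT.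
have wxz' : next c w \in [set x; z] by rewrite e !inE eqxx orbT.
move: xw zw wxz wxz'; rewrite !inE.
case: (eqVneq x w) => [-> _ | xNw /= /eqP ex _]; last first.
  move=> /eqP <- _; rewrite ex mem_next prev_next //.
  by split=> //; right.
move=> zw _ wz; split=> //; left.
case/orP: wz => [/eqP nw|/eqP-> //].
by move: zw; rewrite nw orbb => /eqP->.
Qed.

Lemma odd_cycle_alternating_cover (c : seq V) : uniq c -> odd (size c) ->
  exists C : {set V}, [/\ vertex_cover (cycle_graph c) C,
    C \subset [set x in c] & #|C| <= uphalf (size c)].
Proof.
(* The vertices of even rank: the last vertex and the first one, which are
   adjacent, both have even rank. *)
move=> uc oc; exists [set x in c | ~~ odd (index x c)]; split.
- apply/vertex_coverP.
  suff cov w : w \in c -> ~~ odd (index w c) || ~~ odd (index (next c w) c).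
    move=> x y /(adj_cycle_graph uc)[xc [->|->]];
      rewrite !inE xc ?mem_next ?mem_prev xc /=; first exact: cov.
    by rewrite -{1}(next_prev uc x) orbC; apply: cov; rewrite mem_prev.
  move=> wc; case: (boolP (odd (index w c))) => //= ow.
  rewrite next_nth wc; move: wc ow uc oc; case: c => // y q wc ow uc oc.
  have lt : (index w (y :: q)).+1 < size (y :: q).
    have := wc; rewrite -index_mem => lt; rewrite ltn_neqAle lt andbT.
    by apply/eqP => e; move: oc; rewrite -e /= ow.
  rewrite -[nth y q _]/(nth y (y :: q) (index w (y :: q)).+1).
  by rewrite index_uniq //= negbK.
- by apply/subsetP => x; rewrite !inE => /andP[].
case: c uc oc => // x0 q; set c := x0 :: q => uc oc.
have sub : [set x in c | ~~ odd (index x c)] \subset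
   [set nth x0 c i.*2 | i : 'I_(uphalf (size c)) in setT].
  apply/subsetP => x; rewrite !inE => /andP[xc ev].
  have lt : (index x c)./2 < uphalf (size c).
    by rewrite uphalf_half oc ltnS half_leq // ltnW // index_mem.
  apply/imsetP; exists (Ordinal lt) => //=.
  by rewrite even_halfK // nth_index.
apply: leq_trans (subset_leq_card sub) _.
by apply: leq_trans (leq_imset_card _ _) _; rewrite cardsT card_ord.
Qed.

(** As long as two adjacent weights differ an edge can be peeled off or a vertex
    dropped.  Once the weight is a constant c, the packing consists of c copies
    of the whole cycle and the alternating cover has the same weight. *)
Lemma odd_cycle_packable G a : simple_graph G -> odd_cycle G -> packable G a.
Proof.
move=> sG [[c [uc sc eG]] oG].
rewrite -/(cycle_graph c) in eG.
have oc : odd (size c) by move: oG; rewrite eG /= cardsE (card_uniqP uc).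
have [m] := ubnP (\sum_v a v); elim: m => // m IH in a *; rewrite ltnS => sa.
have {}IH b : \sum_v b v < \sum_v a v -> packable G b.
  by move=> lt; apply: IH; apply: leq_trans lt sa.
have adjn x : x \in c -> adj G x (next c x) by rewrite eG; apply: cycle_graph_adj.
have adjp x : x \in c -> adj G x (prev c x).
  by move=> xc; rewrite adjC -{2}(next_prev uc x) adjn ?mem_prev.
have nbr x z : adj G x z -> z = next c x \/ z = prev c x.
  by rewrite eG => /(adj_cycle_graph uc)[].
have [x /andP[xc lt]|down] :=
  pickP (fun x => (x \in c) && (a (next c x) < a x)).
  exact: (packable_degree2 sG (adjn _ xc) (adjp _ xc) (nbr x)).
have [x /andP[xc lt]|up] :=
  pickP (fun x => (x \in c) && (a (prev c x) < a x)).
  apply: (packable_degree2 sG (adjp _ xc) (adjn _ xc) _ lt IH).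
  by move=> z /nbr[]; [right|left].
have inv : invariant (next c) a =1 xpredT.
  move=> x; rewrite /= eqn_leq; case: (boolP (x \in c)) => [xc|xc].
    have := down x; have := up (next c x).
    rewrite mem_next xc /= prev_next // => /negbT; rewrite -leqNgt => ->.
    by move/negbT; rewrite -leqNgt.
  by rewrite next_nth (negPf xc) leqnn.
have [x0 x0c] : exists x, x \in c by case: (c) sc => // x q; exists x; rewrite inE eqxx.
have const v : v \in c -> a v = a x0.
  move=> vc; symmetry; apply: (fconnect_invariant inv).
  by rewrite (fconnect_cycle (cycle_next uc)).
have [C [cC sC szC]] := odd_cycle_alternating_cover uc oc.
exists C, (nseq (a x0) [set x in c]); split.
- by rewrite eG.
- move=> X /nseqP[-> _]; right; exists G; last by rewrite eG.
  by split; [split|split=> //; exists c].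
- move=> v; rewrite /load big_nseq iter_addn_0 !inE.
  by case: (boolP (v \in c)) => [/const->|]; rewrite ?mul1n ?mul0n.
rewrite /value big_nseq iter_addn_0 cardsE (card_uniqP uc) /weight.
rewrite (eq_bigr (fun _ => a x0)) => [|v /(subsetP sC)]; last first.
  by rewrite inE => /const.
by rewrite sum_nat_const leq_mul2r szC orbT.
Qed.

(** * Clique-sums *)

(** Let c0 be the least weight, outside the clique W, of a cover of G2 that
    contains W, and c(w) the least one of a cover that misses w, hence contains
    the rest of W.  The weight a(w) is split so that G2 receives c(w) - c0, the
    price that G2 charges for w not being in the cover, if a(w) suffices.  Then
    every cover of G2 has a2-weight at least a2(W) + c0, whichever vertex of W
    it misses.  A cover of G1 therefore extends to a cover
    of the union at this additional cost, and the two packings add up. *)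
Lemma packable_clique_sum G1 G2 (W : {set V}) :
    simple_graph G1 -> simple_graph G2 ->
    graph_inter G1 G2 = complete_graph W ->
    (forall a, packable G1 a) -> (forall a, packable G2 a) ->
  forall a, packable (graph_union G1 G2) a.
Proof.
move=> s1 s2 [defW /setP edgesW] pk1 pk2 a.
have inW v : (v \in W) = (v \in vertices G1) && (v \in vertices G2).
  by rewrite -defW inE.
have clW x y : x \in W -> y \in W -> x != y -> adj G1 x y && adj G2 x y.
  move=> xW yW xy; have := edgesW [set x; y]; rewrite !inE cards2 xy /= => ->.
  by rewrite andbT; apply/subsetP => v; rewrite !inE => /orP[] /eqP->.
(* b is the part of the weight that belongs to G2 alone; c0 is the b-weight of
   D0 and c(w) the one of Dw w. *)
pose b v := if (v \in vertices G2) && (v \notin vertices G1) then a v else 0.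
have [D0 /andP[cD0 WD0] minD0] :=
  @arg_minnP _ [set: V] (fun D : {set V} => vertex_cover G2 D && (W \subset D))
    (weight b) (introT andP (conj (vertex_coverT G2) (subsetT W))).
have /choice[Dw /all_and3[cDw wDw minDw]] : forall w, exists D : {set V},
    [/\ vertex_cover G2 D, w \notin D & forall D' : {set V},
        vertex_cover G2 D' -> w \notin D' -> weight b D <= weight b D'].
  move=> w; have P0 : vertex_cover G2 [set~ w] && (w \notin [set~ w]).
    by rewrite vertex_coverC1 // !inE eqxx.
  have [D /andP[cD wD] minD] := @arg_minnP _ [set~ w]
    (fun D : {set V} => vertex_cover G2 D && (w \notin D)) (weight b) P0.
  by exists D; split=> // D' cD' wD'; apply: minD; rewrite cD'.
have D0_le w : w \in W -> weight b D0 <= weight b (Dw w).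
  move=> wW; apply: leq_trans (_ : weight b (W :|: Dw w) <= _).
    by apply: minD0; rewrite subsetUl (vertex_coverS (subsetUr _ _) (cDw w)).
  rewrite !weightE; apply: leq_sum => v _; rewrite inE /b.
  by case: ifP => [/andP[_ v1]|_]; rewrite ?muln0 // inW (negPf v1).
pose a2 v := if v \in vertices G2 then
  if v \in W then minn (a v) (weight b (Dw v) - weight b D0) else a v else 0.
pose a1 v := if v \in vertices G1 then a v - a2 v else 0.
have a12 v : a1 v + a2 v <= a v.
  rewrite /a1 /a2 inW; case: (v \in vertices G1); case: (v \in vertices G2) => //=.
    by rewrite subnK // geq_minl.
  by rewrite subn0 addn0.
have [C1 [L1 [cC1 bL1 lL1 wC1]]] := pk1 a1.
have [C2 [L2 [cC2 bL2 lL2 wC2]]] := pk2 a2.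
have a2_split D : weight a2 D = weight a2 (D :&: W) + weight b D.
  rewrite !weightE -big_split; apply: eq_bigr => v _ /=; rewrite inE /a2 /b inW.
  by case: (v \in D); case: (v \in vertices G2); case: (v \in vertices G1);
     rewrite ?mul1n ?mul0n ?addn0.
have wC2' : weight a2 W + weight b D0 <= weight a2 C2.
  rewrite [leqRHS]a2_split; have [WC2|/subsetPn[w wW wC2']] := boolP (W \subset C2).
    by rewrite (setIidPr WC2) leq_add2l; apply: minD0; rewrite cC2.
  rewrite (_ : C2 :&: W = W :\ w); last first.
    apply/setP => v; rewrite !inE andbC.
    case: (boolP (v \in W)) => vW; rewrite ?andbF //=.
    case: (eqVneq v w) => [->|vw]; first exact/negbTE.
    rewrite eq_sym in vw; have /andP[_ wv] := clW _ _ wW vW vw.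
    exact: (adj_covered cC2 wv wC2').
  rewrite (weightD1 a2 wW) addnAC addnC leq_add2l.
  apply: leq_trans (minDw w _ cC2 wC2').
  have : a2 w <= weight b (Dw w) - weight b D0.
    by rewrite /a2 wW; case: ifP => // _; apply: geq_minr.
  by have := D0_le _ wW; lia.
(* Vertices that are free for G1 are added to its cover, so that a vertex of W
   which it misses has a1 w > 0 and G2 received the full price c(w) - c0. *)
pose Z := [set w in W | a1 w == 0].
have cZ : vertex_cover G1 (C1 :|: Z) by apply: vertex_coverS cC1; apply: subsetUl.
have wZ : weight a1 (C1 :|: Z) <= weight a1 C1.
  rewrite !weightE; apply: leq_sum => v _; rewrite !inE.
  by case: (v \in C1) => //=; case: eqP => [->|]; rewrite ?muln0 ?andbF.
(* D is the continuation of the cover to G2 and W' its trace on W. *)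
suff [D [W' [cD W'W W'C1 W'D wD]]] : exists D W' : {set V},
    [/\ vertex_cover G2 D, W' \subset W, W' \subset C1 :|: Z,
        W :&: (C1 :|: Z :|: D) \subset W' &
        weight a2 W' + weight b D <= weight a2 W + weight b D0].
  exists ((C1 :|: Z) :&: vertices G1 :|: D :&: vertices G2), (L1 ++ L2); split.
  - apply/vertex_coverP => x y; rewrite /adj inE !in_setU !in_setI => /orP[] xy.
      have [/subsetP sub _] := s1 _ xy.
      have := vertex_coverP _ _ cZ _ _ xy.
      rewrite (sub x) ?(sub y) ?inE ?eqxx ?orbT // !andbT.
      by case/orP=> ->; rewrite ?orbT.
    have [/subsetP sub _] := s2 _ xy.
    have := vertex_coverP _ _ cD _ _ xy.
    rewrite (sub x) ?(sub y) ?inE ?eqxx ?orbT // !andbT.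
    by case/orP=> ->; rewrite ?orbT.
  - move=> X; rewrite mem_cat => /orP[/bL1|/bL2] [eX|[H [[sVH sEH] oH] eH]].
    + by left; rewrite inE eX.
    + by right; exists H => //; split=> //; split; apply: subset_trans (subsetUl _ _).
    + by left; rewrite inE eX orbT.
    + by right; exists H => //; split=> //; split; apply: subset_trans (subsetUr _ _).
  - by move=> v; rewrite load_cat (leq_trans _ (a12 v)) // leq_add.
  rewrite /value big_cat /= -!/(value _).
  apply: leq_trans (leq_add wC1 (leq_trans wC2' wC2)).
  apply: leq_trans (leq_add wZ wD).
  rewrite !weightE -!big_split; apply: leq_sum => v _ /=.
  have := subsetP W'W v; have := subsetP W'C1 v; have := subsetP W'D v.
  rewrite [v \in _ :&: (_ :|: D)]in_setI in_setU inW.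
  rewrite [v \in _ :|: (_ :&: _)]in_setU ![v \in _ :&: vertices _]in_setI.
  move: (C1 :|: Z) => C' W'D' W'C' W'W''.
  have [v1|v1] := boolP (v \in vertices G1); last first.
    rewrite andbF /= /b v1 andbT; case: ifP => [_|_]; last by rewrite andbF.
    by rewrite andbT -[leqLHS]add0n -[leqLHS]add0n !leq_add.
  have [v2|v2] := boolP (v \in vertices G2); last first.
    by rewrite andbF orbF andbT /a1 v1 /a2 (negPf v2) subn0 leq_addr.
  rewrite !andbT; move: W'D'; rewrite v1 v2 /= => W'D'.
  case: (boolP ((v \in C') || (v \in D))) => //= CD.
  rewrite (W'C' (W'D' CD)) (W'D' CD) !mul1n addnA /a1 v1.
  by rewrite (leq_trans _ (leq_addr _ _)) // addnC -leq_subLR.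
have [WC1|/subsetPn[w wW wC1']] := boolP (W \subset C1 :|: Z).
  by exists D0, W; split=> //; apply: subsetIl.
exists (Dw w), (W :\ w); split=> //.
- by apply: subsetDl.
- apply/subsetP => v; rewrite in_setD1 => /andP[vw vW]; rewrite eq_sym in vw.
  have /andP[wv _] := clW _ _ wW vW vw.
  exact: (adj_covered cZ wv wC1').
- apply/subsetP => v; rewrite in_setI in_setD1 => /andP[vW].
  rewrite vW andbT in_setU.
  by apply: contraTN => /eqP->; rewrite negb_or wC1' wDw.
have a1w : 0 < a1 w.
  by move: wC1'; rewrite in_setU inE wW /= lt0n negb_or => /andP[].
have a2w : a2 w = weight b (Dw w) - weight b D0.
  move: a1w; have := wW; rewrite inW /a1 /a2 wW => /andP[-> ->].
  by rewrite subn_gt0 /minn; case: ifP => //; rewrite ltnn.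
by rewrite (weightD1 a2 wW) a2w; have := D0_le _ wW; lia.
Qed.

Lemma graph_union_simple G1 G2 :
  simple_graph G1 -> simple_graph G2 -> simple_graph (graph_union G1 G2).
Proof.
move=> s1 s2 e; rewrite inE => /orP[/s1|/s2] [sub ->]; split=> //.
  exact: subset_trans (subsetUl _ _).
exact: subset_trans (subsetUr _ _).
Qed.

Lemma clique_sum_simple (P : graph V -> Prop) G :
  (forall H, P H -> simple_graph H) -> clique_sum P G -> simple_graph G.
Proof.
move=> sP; elim=> [H /sP //|G1 G2 W _ s1 _ s2 _ _ _ _].
exact: graph_union_simple.
Qed.

Theorem clique_sum_packable G a :
  clique_sum (@odd_cycle_or_bipartite V) G -> packable G a.
Proof.
move=> cs; elim: cs a => [H [sH _ [oH|bH]] a|G1 G2 W cs1 pk1 cs2 pk2 _ eW _ _].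
- exact: odd_cycle_packable.
- exact: bipartite_packable.
by apply: (packable_clique_sum _ _ eW) => //;
  [move: cs1|move: cs2]; apply: clique_sum_simple => H [].
Qed.

(** * Trading odd cycles for edges *)

Definition far G X Y : bool := [forall x in X, forall y in Y, ~~ adj G x y].

Lemma sum_load L D : \sum_(v in D) load L v = \sum_(X <- L) #|X :&: D|.
Proof.
rewrite exchange_big; apply: eq_bigr => X _ /=.
rewrite -sum1_card [RHS](eq_bigl (fun v => (v \in D) && (v \in X))).
  by rewrite big_mkcondr; apply: eq_bigr => v _; case: (v \in X).
by move=> v; rewrite inE andbC.
Qed.

Lemma path_matching G (s : seq V) :
  sorted (adj G) s -> uniq s -> ~~ odd (size s) -> exists M : seq {set V},
    [/\ {subset M <= edges G}, size M = (size s)./2 &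
        forall v, load M v = (v \in s)].
Proof.
have [m] := ubnP (size s); elim: m s => // m IH [|x [|y s]] //= lt.
  by exists [::]; split=> // v; rewrite load_nil.
case/andP=> xy pys /and3P[xNs ys us]; rewrite negbK => es.
have [M [sM zM lM]] : exists M : seq {set V}, [/\ {subset M <= edges G},
    size M = (size s)./2 & forall v, load M v = (v \in s)].
  by apply: IH => //; [lia|apply: path_sorted pys].
exists ([set x; y] :: M); split=> [X||v].
- by rewrite inE => /predU1P[->|/sM].
- by rewrite /= zM.
rewrite load_cons lM !inE.
move: xNs; rewrite inE negb_or => /andP[xy' xs].
case: (eqVneq v x) => [->|vx] /=; first by rewrite (negPf xs).
by case: (eqVneq v y) => [->|vy] //=; rewrite (negPf ys).
Qed.

Section OddCycle.
Variables (G : graph V) (X : {set V}).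
Hypothesis oX : odd_cycle_set G X.

Lemma odd_cycle_set_from x : x \in X ->
  exists s, [/\ uniq (x :: s), X = [set v in x :: s], ~~ odd (size s),
    0 < size s & cycle (adj G) (x :: s)].
Proof.
case: oX => H [[_ sE] [[c [uc sc eH]] oH]] <-.
have cE : vertices H = [set v in c] by rewrite eH.
rewrite cE inE => xc; case: (rot_to xc) => i s er; exists s.
have us : uniq (x :: s) by rewrite -er rot_uniq.
split=> //.
- by apply/setP => v; rewrite !inE -(mem_rot i c) er inE.
- by move: oH; rewrite cE cardsE (card_uniqP uc) -(size_rot i) er.
- by move: sc; rewrite -(size_rot i) er /=; lia.
rewrite -er rot_cycle; apply: (@sub_in_cycle _ (mem c) (frel (next c))).
- move=> u v /= uc' _ /eqP <-; apply: (subsetP sE).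
  by rewrite eH; apply/imsetP; exists u.
- by apply/allP.
exact: cycle_next.
Qed.

Lemma odd_cycle_set_odd : odd #|X|.
Proof. by case: oX => H [_ [_ oH]] <-. Qed.

Lemma odd_cycle_set_inhabited : exists x, x \in X.
Proof.
by apply/set0Pn; rewrite -card_gt0; have := odd_cycle_set_odd; case: #|_|.
Qed.

Lemma odd_cycle_set_adj x : x \in X -> exists2 y, y \in X & adj G x y.
Proof.
move=> xX; have [[|y s] [_ -> _ // _ /=]] := odd_cycle_set_from xX.
by case/andP=> xy _; exists y => //; rewrite !inE eqxx orbT.
Qed.

(** Odd cycles are factor-critical, which is what allows trading them for
    edges. *)
Lemma odd_cycle_set_matching x : x \in X -> exists M : seq {set V},
  [/\ {subset M <= edges G}, size M = #|X|./2 & forall v, load M v = (v \in X :\ x)].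
Proof.
move=> xX; have [s [/= /andP[xs us] eX es _ cs]] := odd_cycle_set_from xX.
have ss : sorted (adj G) s.
  by move: cs; rewrite /= rcons_path => /andP[/path_sorted].
have [M [sM zM lM]] := path_matching ss us es.
exists M; split=> // [|v].
  have uxs : uniq (x :: s) by rewrite /= xs.
  by rewrite zM eX cardsE (card_uniqP uxs) /= uphalf_half (negPf es).
by rewrite lM eX !inE; case: (eqVneq v x) => [->|] //=; rewrite (negPf xs).
Qed.

(** One vertex x of X in the cover, and one more for each edge of a perfect
    matching of the rest of X. *)
Lemma odd_cycle_set_cover C :
  simple_graph G -> vertex_cover G C -> uphalf #|X| <= #|C :&: X|.
Proof.
move=> sG cC.
have [x xX xC] : exists2 x, x \in X & x \in C.
  have [x xX] := odd_cycle_set_inhabited.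
  have [y yX xy] := odd_cycle_set_adj xX.
  by have /orP[] := vertex_coverP _ _ cC _ _ xy; [exists x|exists y].
have [M [sM zM lM]] := odd_cycle_set_matching xX.
rewrite uphalf_half odd_cycle_set_odd [leqRHS](cardsD1 x) inE xX xC leq_add2l -zM.
have -> : #|(C :&: X) :\ x| = \sum_(v in C) load M v.
  rewrite -sum1_card big_mkcond [RHS]big_mkcond; apply: eq_bigr => v _ /=.
  by rewrite lM !inE; case: (v \in C); rewrite ?andbF //=; case: (_ && _).
rewrite sum_load -sum1_size big_seq [leqRHS]big_seq; apply: leq_sum => e eM.
exact: vertex_cover_edge sG cC (sM _ eM).
Qed.

End OddCycle.

Lemma far_sym G X Y : far G X Y = far G Y X.
Proof.
by apply/'forall_in_forall_inP/'forall_in_forall_inP => h x xX y yY;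
  rewrite adjC h.
Qed.

Lemma farPn G X Y :
  reflect (exists x y, [/\ x \in X, y \in Y & adj G x y]) (~~ far G X Y).
Proof.
apply: (iffP idP) => [|[x [y [xX yY xy]]]].
  rewrite negb_forall_in => /exists_inP[x xX]; rewrite negb_forall_in.
  by case/exists_inP=> y yY; rewrite negbK; exists x, y.
by apply/negP => /forall_inP/(_ x xX)/forall_inP/(_ y yY); rewrite xy.
Qed.

(** A common vertex would be adjacent to its neighbour along Y. *)
Lemma far_disjoint G X Y x :
  odd_cycle_set G Y -> far G X Y -> x \in X -> x \in Y -> False.
Proof.
move=> oY /forall_inP fXY xX xY.
have [y yY xy] := odd_cycle_set_adj oY xY.
by have /forall_inP/(_ y yY) := fXY x xX; rewrite xy.
Qed.

Lemma load_pairwise_far G R v : (forall X, X \in R -> odd_cycle_set G X) ->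
  pairwise (far G) R -> load R v <= 1.
Proof.
elim: R => [|X R IH] oR; first by rewrite load_nil.
case/andP=> /allP fX pR; rewrite load_cons.
have oR' Y : Y \in R -> odd_cycle_set G Y.
  by move=> YR; apply: oR; rewrite inE YR orbT.
case: (boolP (v \in X)) => vX; last by rewrite IH.
rewrite /load big_seq big1 // => Y YR; apply/eqP; rewrite eqb0; apply/negP.
exact: far_disjoint (oR' _ YR) (fX _ YR) vX.
Qed.

Lemma size_pairwise_far G R : (forall X, X \in R -> odd_cycle_set G X) ->
  pairwise (far G) R -> size R <= #|V|.
Proof.
move=> oR pR; rewrite -cardsT -sum1_card -sum1_size.
apply: leq_trans (_ : \sum_(v in [set: V]) load R v <= _); last first.
  by apply: leq_sum => v _; apply: load_pairwise_far pR.
rewrite sum_load big_seq [leqRHS]big_seq; apply: leq_sum => X XR.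
rewrite card_gt0; have [x xX] := odd_cycle_set_inhabited (oR _ XR).
by apply/set0Pn; exists x; rewrite in_setI xX in_setT.
Qed.

(** An edge xy between X and Y, together with perfect matchings of X minus x and
    of Y minus y.  X and Y may overlap or even be equal, since loads are counted
    with multiplicity. *)
Lemma pair_matching G X Y :
    simple_graph G -> odd_cycle_set G X -> odd_cycle_set G Y ->
    ~~ far G X Y -> exists M : seq {set V},
  [/\ {subset M <= edges G}, 2 * size M = #|X| + #|Y| &
      forall v, load M v = (v \in X) + (v \in Y)].
Proof.
move=> sG oX oY /farPn[x [y [xX yY xy]]].
have [M [sM zM lM]] := odd_cycle_set_matching oX xX.
have [N [sN zN lN]] := odd_cycle_set_matching oY yY.
exists ([set x; y] :: M ++ N); split=> [e|/=|v].
- by rewrite inE mem_cat => /or3P[/eqP->|/sM|/sN].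
- have := odd_double_half #|X|; have := odd_double_half #|Y|.
  by rewrite (odd_cycle_set_odd oX) (odd_cycle_set_odd oY) size_cat zM zN; lia.
have := adj_neq sG xy; rewrite load_cons load_cat lM lN !in_setD1 in_set2.
case: (eqVneq v x) => [->|_] /=; last first.
  by case: (eqVneq v y) => [->|//]; rewrite yY; lia.
by rewrite xX => /negPf->; lia.
Qed.

(** Greedy pairing: R collects the cycles that have found no partner yet.  A new
    cycle is paired with a member of R which is not far from it, if any. *)
Lemma pair_odd_cycles G L :
    simple_graph G -> (forall X, X \in L -> odd_cycle_set G X) ->
  exists M R : seq {set V}, [/\ {subset M <= edges G}, {subset R <= L},
    pairwise (far G) R,
    size R <= size L /\
      \sum_(X <- L) #|X| = 2 * size M + \sum_(X <- R) #|X| &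
    forall v, load M v + load R v <= load L v].
Proof.
move=> sG; elim: L => [|X L IH] oL.
  by exists [::], [::]; split=> // v; rewrite !load_nil.
have oL' Y : Y \in L -> odd_cycle_set G Y.
  by move=> YL; apply: oL; rewrite inE YL orbT.
have oX : odd_cycle_set G X by apply: oL; rewrite inE eqxx.
have [M [R [sM sR pR [zR eR] lR]]] := IH oL'.
have [fX|/allPn[Y YR nf]] := boolP (all (far G X) R).
  exists M, (X :: R); split=> //=.
  - by move=> Y; rewrite !inE => /predU1P[->|/sR->]; rewrite ?eqxx ?orbT.
  - by rewrite fX.
  - by rewrite !big_cons eR addnCA.
  - by move=> v; rewrite !load_cons addnCA leq_add2l.
have [N [sN zN lN]] := pair_matching sG oX (oL' _ (sR _ YR)) nf.
have pY := perm_to_rem YR.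
exists (N ++ M), (rem Y R); split=> //.
- by move=> e; rewrite mem_cat => /orP[/sN|/sM].
- by move=> Z /mem_rem/sR ZL; rewrite inE ZL orbT.
- by apply: subseq_pairwise pR; apply: rem_subseq.
- split; first by rewrite size_rem //; move: zR => /=; lia.
  move: eR; rewrite (perm_big _ pY) /= !big_cons => ->.
  by rewrite size_cat; lia.
- move=> v; move: (lR v); rewrite load_cat load_cons lN.
  by rewrite /load (perm_big _ pY) /= big_cons; lia.
Qed.

(** The cycles that stay single in the pairing contribute one edge less than
    half of their size, rounded up. *)
Lemma odd_cycles_matching G L :
    simple_graph G -> (forall X, X \in L -> odd_cycle_set G X) ->
  exists M R : seq {set V}, [/\ {subset M <= edges G}, {subset R <= L},
    pairwise (far G) R,
    size R <= size L /\ \sum_(X <- L) #|X| <= 2 * size M + size R &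
    forall v, load M v <= load L v].
Proof.
move=> sG oL; have [M [R [sM sR pR [zR eR] lR]]] := pair_odd_cycles sG oL.
have [N [sN zN lN]] : exists N : seq {set V}, [/\ {subset N <= edges G},
    \sum_(X <- R) #|X| <= 2 * size N + size R & forall v, load N v <= load R v].
  have oR X : X \in R -> odd_cycle_set G X by move/sR/oL.
  elim: (R) oR => [|X R' IH] oR.
    by exists [::]; rewrite big_nil; split.
  have oX : odd_cycle_set G X by apply: oR; rewrite inE eqxx.
  have [N [sN zN lN]] : exists N : seq {set V}, [/\ {subset N <= edges G},
      \sum_(X <- R') #|X| <= 2 * size N + size R' & forall v, load N v <= load R' v].
    by apply: IH => Y YR; apply: oR; rewrite inE YR orbT.
  have [x xX] := odd_cycle_set_inhabited oX.
  have [P [sP zP lP]] := odd_cycle_set_matching oX xX.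
  exists (P ++ N); split.
  - by move=> e; rewrite mem_cat => /orP[/sP|/sN].
  - have := odd_double_half #|X|.
    rewrite (odd_cycle_set_odd oX) big_cons size_cat zP /=.
    by move: (\sum_(Y <- R') #|Y|) zN => t zN e; lia.
  - move=> v; rewrite load_cat load_cons leq_add // lP.
    by rewrite in_setD1; case: (v \in X); rewrite ?andbF // leq_b1.
exists (N ++ M), R; split=> //.
- by move=> e; rewrite mem_cat => /orP[/sN|/sM].
- by split=> //; rewrite eR size_cat; lia.
- by move=> v; rewrite load_cat; have := lR v; have := lN v; lia.
Qed.

(** * From covers of given weight to matchings of given size *)

Definition matchable G t a : Prop := exists M : seq {set V},
  [/\ {subset M <= edges G}, t <= size M & forall v, load M v <= a v].

Lemma packable_split G a s : simple_graph G -> packable G a ->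
    (forall C, vertex_cover G C -> s <= weight a C) ->
  exists M L : seq {set V}, [/\ {subset M <= edges G},
    forall X, X \in L -> odd_cycle_set G X, forall v, load M v + load L v <= a v &
    s <= size M + value L].
Proof.
move=> sG [C [L0 [cC bL lL wL]]] /(_ C cC) sC.
have {sC wL} := leq_trans sC wL.
suff [M [L [sM oL lML vL]]] : exists M L : seq {set V},
    [/\ {subset M <= edges G}, forall X, X \in L -> odd_cycle_set G X,
        forall v, load M v + load L v = load L0 v &
        value L0 = size M + value L].
  by move=> sL0; exists M, L; split=> // [v|]; rewrite ?lML // -vL.
elim: L0 bL {lL} => [|X L0 IH] bL.
  by exists [::], [::]; split=> // v; rewrite load_nil.
have [Y YL|M [L [sM oL lML vL]]] := IH.
  by apply: bL; rewrite inE YL orbT.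
have [eX|oX] := bL X (mem_head _ _).
  exists (X :: M), L; split=> // [e|v|].
  - by rewrite inE => /predU1P[->|/sM].
  - by rewrite !load_cons -lML addnA.
  - by have [_ zX] := sG _ eX; rewrite /value big_cons -/(value L0) vL zX.
exists M, (X :: L); split=> // [Y|v|].
- by rewrite inE => /predU1P[->|/oL].
- by rewrite !load_cons -lML addnCA.
- by rewrite /value !big_cons -/(value L0) -/(value L) vL addnCA.
Qed.

(** The ratio of the value m + 1 to half the size is (2m + 2) / (2m + 1), which
    decreases with m. *)
Lemma value_odd_cycles G n L : (forall X, X \in L -> odd_cycle_set G X) ->
    (forall X, X \in L -> 2 * n + 1 <= #|X|) ->
  2 * (2 * n + 1) * value L <= (2 * n + 2) * \sum_(X <- L) #|X|.
Proof.
move=> oL zL; rewrite /value !big_distrr /= big_seq [leqRHS]big_seq.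
apply: leq_sum => X XL; have := zL X XL; have := odd_double_half #|X|.
rewrite uphalf_half (odd_cycle_set_odd (oL X XL)) => <-.
by move: (#|X|./2) => h; nia.
Qed.

Lemma value_odd_cycles_eq n L : (forall X, X \in L -> #|X| = 2 * n + 1) ->
  value L = size L * (n + 1) /\ \sum_(X <- L) #|X| = size L * (2 * n + 1).
Proof.
elim: L => [|X L IH] zL; first by rewrite /value !big_nil.
have [Y YL|e1 e2] := IH; first by apply: zL; rewrite inE YL orbT.
have zX := zL X (mem_head _ _).
rewrite /value !big_cons -/(value L) e1 e2 zX /= !(mulSn (size L)).
split; last by lia.
by rewrite addn1 mul2n uphalf_half /= odd_double uphalf_double addn1.
Qed.

(** Arithmetic of the asymptotic case.  A packing with m edges and cycles of
    total value p and total size S leaves k of them single, and z is the number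
    of edges obtained from the cycles.  Each of the at most w single cycles
    costs half an edge; multiplying by r the margin of the strict inequality
    makes up for that. *)
Lemma asymptotic_bound n s t r w S z k m p :
    t * (2 * n + 2) < s * (2 * n + 1) -> w * (n + 1) <= r ->
    S <= 2 * z + k -> k <= w -> s * r <= m + p ->
    2 * (2 * n + 1) * p <= (2 * n + 2) * S ->
  t * r <= m + z.
Proof.
move=> st rw Sz kw smp vS.
have h1 : (t * (2 * n + 2)).+1 * r <= s * (2 * n + 1) * r by rewrite leq_mul.
have h2 : s * r * (2 * n + 1) <= (m + p) * (2 * n + 1) by rewrite leq_mul.
have h3 : (2 * n + 2) * S <= (2 * n + 2) * (2 * z + w).
  by rewrite leq_mul // (leq_trans Sz) // leq_add2l.
have n0 : 0 < (2 * n + 2) * 2 by lia.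
by rewrite -(leq_pmul2l n0); nia.
Qed.

(** Arithmetic for c cycles of size 2n + 1 of which r stay single.  With
    c = r + q, what the cycles contribute is controlled by the inequality
    q (k - 2) + 2 (k - r) >= 0. *)
Lemma equal_cycles_bound n k s t m c z r : 2 <= k ->
    t * (k * n + k) < s * (k * n + 1) ->
    r <= k -> r <= c -> s <= m + c * (n + 1) -> c * (2 * n + 1) <= 2 * z + r ->
  t <= m + z.
Proof.
move=> k2 st rk rc sm cz; rewrite leqNgt; apply/negP => tz.
have h1 : (m + z).+1 * (k * n + k) <= t * (k * n + k) by rewrite leq_mul.
have h2 : s * (k * n + 1) <= (m + c * (n + 1)) * (k * n + 1) by rewrite leq_mul.
have h3 : 2 * (m + z).+1 * (k * n + k) < 2 * (m + c * (n + 1)) * (k * n + 1) by lia.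
have h4 : (c * (2 * n + 1) + 2) * (k * n + k) <= (2 * z + r + 2) * (k * n + k).
  by rewrite leq_mul // leq_add2r.
have [q eq] : exists q, c = r + q by exists (c - r); lia.
have h5 : 2 * q * (n + 1) <= k * q * (n + 1) by rewrite !leq_mul.
have h6 : r * (n + 1) <= k * (n + 1) by rewrite leq_mul.
have h7 : 2 * m <= k * m by rewrite leq_mul.
subst c; clear tz st sm cz; move: h3 h4 h5 h6 h7; clear.
rewrite !(mulnDl, mulnDr, mulnA, mulnS, mulSn, muln1, mul1n).
lia.
Qed.

Lemma matchable_asymptotic G n a s t r :
    simple_graph G -> packable G a ->
    (forall X, odd_cycle_set G X -> 2 * n + 1 <= #|X|) ->
    t * (2 * n + 2) < s * (2 * n + 1) -> #|V| * (n + 1) <= r ->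
    (forall C, vertex_cover G C -> s * r <= weight a C) ->
  matchable G (t * r) a.
Proof.
move=> sG pG zG st rV cov.
have [M [L [sM oL lML vL]]] := packable_split sG pG cov.
have [N [R [sN sR pR [_ zN] lN]]] := odd_cycles_matching sG oL.
have zR : size R <= #|V| by apply: size_pairwise_far pR => X /sR/oL.
exists (M ++ N); split=> [e||v]; first by rewrite mem_cat => /orP[/sM|/sN].
  have := value_odd_cycles oL (fun X XL => zG X (oL X XL)).
  by rewrite size_cat; apply: asymptotic_bound st rV zN zR vL.
by rewrite load_cat; apply: leq_trans (lML v); rewrite leq_add2l.
Qed.

Lemma matchable_equal_cycles G n k a s t :
    simple_graph G -> packable G a -> 2 <= k ->
    (forall X, odd_cycle_set G X -> #|X| = 2 * n + 1) ->
    (forall R : seq {set V}, (forall X, X \in R -> odd_cycle_set G X) ->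
       pairwise (far G) R -> size R <= k) ->
    t * (k * n + k) < s * (k * n + 1) ->
    (forall C, vertex_cover G C -> s <= weight a C) ->
  matchable G t a.
Proof.
move=> sG pG k2 zG maxk st cov.
have [M [L [sM oL lML vL]]] := packable_split sG pG cov.
have [N [R [sN sR pR [zRL zN] lN]]] := odd_cycles_matching sG oL.
have zR : size R <= k by apply: maxk => // X /sR/oL.
exists (M ++ N); split=> [e||v]; first by rewrite mem_cat => /orP[/sM|/sN].
  have [vLe zLe] := value_odd_cycles_eq (fun X XL => zG X (oL X XL)).
  rewrite size_cat; move: vL zN; rewrite vLe zLe.
  exact: equal_cycles_bound k2 st zR zRL.
by rewrite load_cat; apply: leq_trans (lML v); rewrite leq_add2l.
Qed.

(** * Monomials of odd cycles *)

Lemma cover_load_odd_cycles G L C : simple_graph G ->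
  (forall X, X \in L -> odd_cycle_set G X) -> vertex_cover G C ->
  value L <= weight (load L) C.
Proof.
move=> sG oL cC; rewrite [weight _ _]sum_load /value big_seq [leqRHS]big_seq.
apply: leq_sum => X XL; rewrite setIC.
exact: odd_cycle_set_cover (oL _ XL) _ sG cC.
Qed.

Lemma matchable_size G t a : simple_graph G -> matchable G t a -> 2 * t <= \sum_v a v.
Proof.
move=> sG [M [sM zM lM]].
apply: leq_trans (_ : \sum_(v in [set: V]) load M v <= _).
  rewrite sum_load (leq_trans (_ : _ <= 2 * size M)) ?leq_mul2l //.
  rewrite -sum1_size big_distrr /= big_seq [leqRHS]big_seq.
  by apply: leq_sum => e /sM/sG[_ ze]; rewrite setIT ze.
by rewrite big_mkcond; apply: leq_sum => v _; rewrite in_setT.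
Qed.

Lemma pairwise_far_mem G R X Y : (forall X, X \in R -> odd_cycle_set G X) ->
  pairwise (far G) R -> X \in R -> Y \in R -> X != Y -> far G X Y.
Proof.
move=> oR /(pairwiseP set0) pR XR YR XY.
rewrite -(nth_index set0 XR) -(nth_index set0 YR).
have : index X R != index Y R.
  by apply: contra XY => /eqP e; rewrite -(nth_index set0 XR) e nth_index.
rewrite neq_ltn => /orP[lt|lt]; last rewrite far_sym; apply: pR => //;
  by rewrite inE index_mem.
Qed.

(** No edge joins two distinct cycles of R and loads are at most one, so a
    matching splits into matchings of the single cycles, of size at most n. *)
Lemma far_matchable_size G R n t : simple_graph G ->
    (forall X, X \in R -> odd_cycle_set G X) -> pairwise (far G) R ->
    (forall X, X \in R -> #|X| = 2 * n + 1) ->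
  matchable G t (load R) -> t <= size R * n.
Proof.
move=> sG oR pR zR [M [sM zM lM]]; apply: (leq_trans zM).
apply: leq_trans (_ : \sum_(X <- R) \sum_(e <- M) (e \subset X) <= _); last first.
  rewrite -sum1_size big_distrl /= big_seq [leqRHS]big_seq; apply: leq_sum => X XR.
  rewrite mul1n.
  have : 2 * (\sum_(e <- M) (e \subset X)) <= 2 * n + 1; last by lia.
  rewrite -(zR X XR) -sum1_card.
  apply: leq_trans (_ : \sum_(v in X) load M v <= _); last first.
    by apply: leq_sum => v _; apply: leq_trans (lM v) (load_pairwise_far v oR pR).
  rewrite sum_load big_distrr /= big_seq [leqRHS]big_seq; apply: leq_sum => e eM.
  case: (boolP (e \subset X)) => // eX; rewrite (setIidPl eX).
  by have [_ ->] := sG _ (sM _ eM).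
rewrite exchange_big /= -sum1_size big_seq [leqRHS]big_seq; apply: leq_sum => e eM.
have [_ /eqP/cards2P[u [v [uv eE]]]] := sG _ (sM _ eM).
have in_cycle w : w \in e -> exists2 X, X \in R & w \in X.
  move=> we; have : 0 < load R w.
    by apply: leq_trans (lM w); rewrite /load (big_rem _ eM) /= we.
  rewrite lt0n /load sum_nat_seq_neq0 => /hasP[X XR wX]; exists X => //.
  by move: wX; case: (w \in X).
have [X XR uX] := in_cycle u ltac:(by rewrite eE !inE eqxx).
have [Y YR vY] := in_cycle v ltac:(by rewrite eE !inE eqxx orbT).
have XY : X = Y.
  apply/eqP; apply: contraT => neXY.
  have /negP[] : ~~ far G X Y.
    by apply/farPn; exists u, v; split=> //; rewrite /adj -eE sM.
  exact: pairwise_far_mem oR pR XR YR neXY.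
by rewrite (big_rem _ XR) /= eE subUset !sub1set uX XY vY.
Qed.

End Weights.

(** * Ideals described by the supports of their elements *)

Section PolynomialSupport.
Import GRing.Theory.
Local Open Scope ring_scope.
Variables (n : nat) (K : fieldType).
Implicit Types (f g u : mpoly n K) (m : multinom n).

Definition supported (Q : multinom n -> Prop) f : Prop :=
  forall m, m \in msupp f -> Q m.

Definition part (P : pred (multinom n)) f : mpoly n K :=
  \sum_(m <- msupp f | P m) mcoeff m f *: mpolyX K m.

Lemma part_split (P : pred (multinom n)) f : f = part P f + part (predC P) f.
Proof. by rewrite {1}[f]mpolyE (bigID P). Qed.

Lemma msupp_part (P : pred (multinom n)) f m :
  m \in msupp (part P f) -> P m /\ m \in msupp f.
Proof.
move/msupp_sum_le/flattenP=> [s /mapP[m']].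
rewrite mem_filter => /andP[Pm' m'f] ->.
by move/msuppZ_le; rewrite msuppX inE => /eqP->.
Qed.

Lemma part_neq0 (P : pred (multinom n)) f m :
  m \in msupp f -> P m -> part P f != 0.
Proof.
move=> mf Pm; apply/negP => /eqP p0.
have : mcoeff m f != 0 by rewrite -mcoeff_msupp.
rewrite (part_split P f) p0 add0r -mcoeff_msupp => /msupp_part[/=].
by rewrite Pm.
Qed.

Lemma msupp_neq0 f : f != 0 -> exists m, m \in msupp f.
Proof.
rewrite -msupp_eq0; case: (msupp f) => // m s _; exists m; exact: mem_head.
Qed.

Lemma msuppM f g m : m \in msupp (f * g) ->
  exists m1 m2, [/\ m1 \in msupp f, m2 \in msupp g & m = mnm_add m1 m2].
Proof. by move/msuppM_le/allpairsP=> [[m1 m2] /= [? ? ->]]; exists m1, m2. Qed.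

(** The least wt-weight of a monomial is a valuation: the parts of least weight
    of u and of f have a nonzero product, whose monomials cannot cancel in u * f
    because all the others have larger weight. *)
Lemma supported_div (wt : multinom n -> nat) (s : nat) u f :
    (forall m1 m2, wt (mnm_add m1 m2) = (wt m1 + wt m2)%N) ->
    (exists2 m, m \in msupp u & wt m = 0%N) ->
    supported (fun m => s <= wt m)%N (u * f) ->
  supported (fun m => s <= wt m)%N f.
Proof.
move=> wtD [m0 m0u wm0] suf m1 m1f.
have ex : exists d, has (fun m => wt m == d) (msupp f).
  by exists (wt m1); apply/hasP; exists m1.
case: (ex_minnP ex) => d /hasP[m2 m2f /eqP wm2] mind.
have minf m : m \in msupp f -> (d <= wt m)%N.
  by move=> mf; apply: mind; apply/hasP; exists m.
apply: leq_trans (minf _ m1f).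
pose u0 := part (fun m => wt m == 0%N) u.
pose f0 := part (fun m => wt m == d) f.
have u0_neq0 : u0 != 0 by apply: (part_neq0 m0u); rewrite wm0.
have f0_neq0 : f0 != 0 by apply: (part_neq0 m2f); rewrite wm2.
have [m m00] := msupp_neq0 (mulf_neq0 u0_neq0 f0_neq0).
have wm : wt m = d.
  have [p [q [/msupp_part[/eqP wp _] /msupp_part[/eqP wq _] ->]]] := msuppM m00.
  by rewrite wtD wp wq.
rewrite -wm; apply: suf.
have -> : u * f = u0 * f0 + (u0 * part (predC (fun m => wt m == d)) f +
    part (predC (fun m => wt m == 0%N)) u * f).
  by rewrite addrA -mulrDr -part_split -mulrDl -part_split.
rewrite mcoeff_msupp mcoeffD [X in _ + X](_ : _ = 0) ?addr0 -?mcoeff_msupp //.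
apply/eqP; rewrite mcoeff_eq0; apply/negP => /msuppD_le; rewrite mem_cat.
case/orP=> /msuppM[p [q [/msupp_part[/= wp pu] qf]]] => [|e].
  move: qf => /msupp_part[/= wq qf] e; have := minf _ qf.
  move: wm; rewrite e wtD (eqP wp) add0n => wqd.
  by rewrite wqd eqxx in wq.
have := minf _ qf; move: wm wp; rewrite e wtD -lt0n; lia.
Qed.

Lemma supported_ideal (Q : multinom n -> Prop) :
  (forall m m', Q m -> Q (mnm_add m' m)) -> ideal (supported Q).
Proof.
move=> Qup; split.
- by move=> m; rewrite (_ : msupp _ = [::]) //; apply/eqP; rewrite msupp_eq0 eqxx.
- by move=> f g Qf Qg m /msuppD_le; rewrite mem_cat => /orP[/Qf|/Qg].
by move=> a f Qf m /msuppM[m1 [m2 [_ /Qf Qm ->]]]; apply: Qup.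
Qed.

Lemma ideal_gen_ideal (A : idomainType) (S : set A) : ideal (ideal_gen S).
Proof.
split.
- by move=> J [[]].
- move=> x y Ix Iy J JS; have [[_ JD _] _] := JS.
  exact: JD (Ix _ JS) (Iy _ JS).
- by move=> a x Ix J JS; have [[_ _ JM] _] := JS; exact: JM (Ix _ JS).
Qed.

Lemma ideal_pow_ideal (A : idomainType) (I : set A) s : ideal (ideal_pow I s).
Proof. by case: s => [|s]; [split|apply: ideal_gen_ideal]. Qed.

Lemma ideal_mulM (A : idomainType) (I J : set A) x y :
  I x -> J y -> ideal_mul I J (x * y).
Proof. by move=> Ix Jy; apply: sub_gen_smallest; exists x, y. Qed.

Lemma ideal_sum (A : idomainType) (I : set A) (T : eqType) (r : seq T)
    (F : T -> A) :
  ideal I -> (forall i, i \in r -> I (F i)) -> I (\sum_(i <- r) F i).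
Proof.
move=> [I0 ID _] IF; rewrite big_seq.
by apply: (big_ind (fun x => I x)) => // i; apply: IF.
Qed.

Lemma ideal_supported (I : set (mpoly n K)) f :
  ideal I -> supported (fun m => I (mpolyX K m)) f -> I f.
Proof.
move=> idI If; rewrite [f]mpolyE; apply: ideal_sum => // m /If Im.
by rewrite -mul_mpolyC; case: idI => _ _; apply.
Qed.

End PolynomialSupport.

(** * Calculus of matchings under a weight *)

Section Matchable.
Import mathcomp.boot.fintype mathcomp.boot.finset.
Local Open Scope set_scope.
Local Open Scope nat_scope.
Variables (V : finType) (G : graph V).
Implicit Types (a b : V -> nat) (t : nat) (x y v w : V).

Lemma matchable_le t a b :
  (forall v, a v <= b v) -> matchable G t a -> matchable G t b.
Proof.
move=> ab [M [sM zM lM]]; exists M; split=> // v.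
exact: leq_trans (lM v) (ab v).
Qed.

Lemma matchable_leq t s a : t <= s -> matchable G s a -> matchable G t a.
Proof.
by move=> ts [M [sM zM lM]]; exists M; split=> //; apply: leq_trans zM.
Qed.

Lemma matchable0 a : matchable G 0 a.
Proof. by exists [::]; split=> // v; rewrite load_nil. Qed.

Lemma matchable_add t1 t2 a b : matchable G t1 a -> matchable G t2 b ->
  matchable G (t1 + t2) (fun v => a v + b v).
Proof.
move=> [M [sM zM lM]] [N [sN zN lN]]; exists (M ++ N); split=> [e||v].
- by rewrite mem_cat => /orP[/sM|/sN].
- by rewrite size_cat leq_add.
- by rewrite load_cat leq_add.
Qed.

Lemma matchable_sum (D : {set V}) (t : V -> nat) (a : V -> V -> nat) :
  (forall v, v \in D -> matchable G (t v) (a v)) ->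
  matchable G (\sum_(v in D) t v) (fun w => \sum_(v in D) a v w).
Proof.
move=> ma.
suff main (r : seq V) : {subset r <= D} ->
    matchable G (\sum_(v <- r) t v) (fun w => \sum_(v <- r) a v w).
  rewrite -big_enum; apply: matchable_le (main (enum D) _) => [w|v].
    by rewrite big_enum.
  by rewrite mem_enum.
elim: r => [|x r IH] rD; first by rewrite big_nil; apply: matchable0.
rewrite big_cons.
apply: matchable_le (matchable_add (ma x _) (IH _)) => [v||v vr].
- by rewrite big_cons.
- by rewrite rD ?mem_head.
- by rewrite rD // inE vr orbT.
Qed.

Lemma matchable1 x y : adj G x y -> matchable G 1 (fun v => v \in [set x; y]).
Proof.
move=> xy; exists [:: [set x; y]]; split=> // [e|v].
  by rewrite inE => /eqP->.
by rewrite load_cons load_nil addn0.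
Qed.

Lemma matchable_mul k a : matchable G 1 a -> matchable G k (fun v => k * a v).
Proof.
move=> ma; elim: k => [|k IH]; first exact: matchable0.
by apply: matchable_le (matchable_add ma IH) => v; rewrite mulSn.
Qed.

Lemma matchableS t a : simple_graph G -> matchable G t.+1 a -> exists x y,
  [/\ adj G x y, forall v, (v \in [set x; y]) <= a v &
      matchable G t (decr a [set x; y])].
Proof.
move=> sG [[|e M] [sM zM lM]] //.
have eG : e \in edges G by apply: sM; rewrite mem_head.
have [_ /eqP/cards2P[x [y [_ ee]]]] := sG _ eG.
subst e; exists x, y; split=> // [v|].
  by apply: leq_trans (lM v); rewrite load_cons leq_addr.
exists M; split=> // [e eM|v]; first by apply: sM; rewrite inE eM orbT.
have := lM v; rewrite load_cons /decr => le_av.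
by rewrite leq_subRL // (leq_trans (leq_addr _ _) le_av).
Qed.

Lemma matchable_weight t a C : simple_graph G -> vertex_cover G C ->
  matchable G t a -> t <= weight a C.
Proof.
move=> sG cC [M [sM zM lM]]; apply: leq_trans zM _.
apply: (leq_trans _ (leq_sum _ (fun v _ => lM v))).
rewrite sum_load -sum1_size big_seq [leqRHS]big_seq; apply: leq_sum => e eM.
exact: vertex_cover_edge sG cC (sM _ eM).
Qed.

Lemma minimal_vertex_cover C : simple_graph G -> vertex_cover G C ->
  exists2 D : {set V}, vertex_cover G D /\ D \subset C &
    forall v, v \in D -> exists2 w, adj G v w & w \notin D.
Proof.
move=> sG /minset_exists[D /minsetP[cD minD] DC]; exists D => // v vD.
case: (pickP (fun w => adj G v w && (w \notin D))) => [w /andP[vw wD]|none].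
  by exists w.
have cDv : vertex_cover G (D :\ v).
  rewrite -[D :\ v]setU0; apply: vertex_cover_swap => // w vw.
  by rewrite setU0; have := none w; rewrite vw /= => /negbFE.
have := minD _ cDv (subD1set _ _) => /setP/(_ v).
by rewrite !inE eqxx vD.
Qed.

Lemma weightD a b (D : {set V}) :
  weight (fun v => a v + b v) D = weight a D + weight b D.
Proof. exact: big_split. Qed.

Lemma weight_gt0 a (D : {set V}) :
  0 < weight a D -> exists2 v, v \in D & 0 < a v.
Proof.
rewrite lt0n /weight sum_nat_eq0 => /forall_inPn[v vD av]; exists v => //.
by rewrite lt0n.
Qed.

End Matchable.

(** * Ordinary and symbolic powers of the edge ideal *)

Section EdgeIdeal.
Import mathcomp.boot.fintype mathcomp.boot.finset.
Import GRing.Theory.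
Local Open Scope ring_scope.
Variables (K : fieldType) (V : finType) (G : graph V).
Hypothesis sG : simple_graph G.
Implicit Types (a b : V -> nat) (t s : nat) (x y v w : V).
Implicit Types (f g : mpoly #|V| K) (m : multinom #|V|).

Definition exponent m v : nat := m (enum_rank v).

Definition mono a : multinom #|V| := Multinom [tuple a (enum_val i) | i < #|V|].

Lemma exponent_mono a : exponent (mono a) = a.
Proof. by apply/funext => v; rewrite /exponent mnmE enum_rankK. Qed.

Lemma mono_exponent m : mono (exponent m) = m.
Proof. by apply/mnmP => i; rewrite mnmE /exponent enum_valK. Qed.

Lemma exponentD m1 m2 v :
  exponent (mnm_add m1 m2) v = (exponent m1 v + exponent m2 v)%N.
Proof. exact: mnmDE. Qed.

Lemma exponent1 v w : exponent (mnm1 (enum_rank v)) w = (v == w).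
Proof. by rewrite /exponent mnm1E (inj_eq enum_rank_inj). Qed.

Lemma monoD a b : mono (fun v => a v + b v)%N = mnm_add (mono a) (mono b).
Proof. by apply/mnmP => i; rewrite mnmDE !mnmE. Qed.

Lemma monomial_div m a : (forall v, a v <= exponent m v)%N ->
  mpolyX K m =
    mpolyX K (mono a) * mpolyX K (mono (fun v => exponent m v - a v)%N).
Proof.
move=> am; rewrite -mpolyXD -monoD -{1}(mono_exponent m).
congr (mpolyX K (mono _)).
by apply/funext => v; rewrite subnKC.
Qed.

Lemma edge_monomial x y : adj G x y ->
  vertex_var K x * vertex_var K y = mpolyX K (mono (fun v => v \in [set x; y]%SET)).
Proof.
move=> xy; rewrite -mpolyXD; congr (mpolyX K _).
rewrite -[LHS]mono_exponent; congr mono; apply/funext => v.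
rewrite exponentD !exponent1 !inE [v == x]eq_sym [v == y]eq_sym.
by have := adj_neq sG xy; case: (eqVneq x v) => [->|] //= ; case: (eqVneq y v).
Qed.

Definition monomial_matchable t m : Prop := matchable G t (exponent m).

Lemma supported_matchable_ideal t :
  ideal (supported (monomial_matchable t) : set (mpoly #|V| K)).
Proof.
apply: supported_ideal => m m'; apply: matchable_le => v.
by rewrite exponentD leq_addl.
Qed.

Lemma edge_ideal_ideal : ideal (edge_ideal K G).
Proof. exact: ideal_gen_ideal. Qed.

Lemma edge_ideal_edge x y :
  adj G x y -> edge_ideal K G (vertex_var K x * vertex_var K y).
Proof. by move=> xy; apply: sub_gen_smallest; exists x, y. Qed.

Lemma edge_idealE f : edge_ideal K G f <-> supported (monomial_matchable 1) f.
Proof.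
split.
  move: f; apply: smallest_sub; first exact: supported_matchable_ideal.
  move=> _ [x [y [xy ->]]] m; rewrite (edge_monomial xy) msuppX inE => /eqP->.
  by rewrite /monomial_matchable exponent_mono; apply: matchable1.
move=> sf; apply: ideal_supported; first exact: edge_ideal_ideal.
move=> m /sf /(matchableS sG)[x [y [xy xym _]]].
rewrite (monomial_div xym) mulrC -edge_monomial //.
by have [_ _] := edge_ideal_ideal; apply; apply: edge_ideal_edge.
Qed.

Lemma edge_ideal_powE t f :
  ideal_pow (edge_ideal K G) t f <-> supported (monomial_matchable t) f.
Proof.
split.
  elim: t f => [|t IH] f; first by move=> _ m _; apply: matchable0.
  move: f; apply: smallest_sub; first exact: supported_matchable_ideal.
  move=> _ [p [q [/edge_idealE sp /IH sq ->]]] m.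
  case/msuppM=> m1 [m2 [/sp h1 /sq h2 ->]].
  apply: matchable_le (matchable_add h1 h2) => v.
  by rewrite exponentD.
move=> sf; apply: ideal_supported; first exact: ideal_pow_ideal.
move=> m /sf; elim: t m {sf f} => [//|t IH] m /(matchableS sG)[x [y [xy xym mt]]].
rewrite (monomial_div xym); apply: ideal_mulM.
  by rewrite -edge_monomial //; apply: edge_ideal_edge.
by apply: IH; rewrite /monomial_matchable exponent_mono.
Qed.

(** The prime generated by the variables of the vertices in D. *)
Definition hits (D : {set V}) : set (mpoly #|V| K) :=
  supported (fun m => 1 <= weight (exponent m) D)%N.

Lemma weight_exponentD D m1 m2 :
  weight (exponent (mnm_add m1 m2)) D =
    (weight (exponent m1) D + weight (exponent m2) D)%N.
Proof.
by rewrite -weightD; congr weight; apply/funext => v; rewrite exponentD.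
Qed.

Lemma not_hits D f :
  ~ hits D f -> exists2 m, m \in msupp f & weight (exponent m) D = 0%N.
Proof.
move=> nf; apply: contrapT => nex; apply: nf => m mf; rewrite lt0n.
by apply/eqP => wm; apply: nex; exists m.
Qed.

Lemma hits_prime D : prime_ideal (hits D).
Proof.
split.
- by apply: supported_ideal => m m' h; rewrite weight_exponentD (leq_trans h) ?leq_addl.
- move/(_ mnm0); rewrite -[1]mpolyC1 msupp1 mem_head => /(_ isT).
  by rewrite /weight big1 // => v _; rewrite /exponent mnm0E.
move=> f g hfg; have [hf|/not_hits nf] := pselect (hits D f); first by left.
by right; apply: supported_div nf hfg => m1 m2; apply: weight_exponentD.
Qed.

(** The annihilator modulo I of the product of all variables outside D: a
    vertex of D has a neighbour outside D by minimality, while the complement of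
    D contains no edge. *)
Lemma hits_associated D : vertex_cover G D ->
    (forall v, v \in D -> exists2 w, adj G v w & w \notin D) ->
  associated_prime (edge_ideal K G) (hits D).
Proof.
move=> cD minD; split; first exact: hits_prime.
pose m0 := mono (fun v => v \notin D : nat); exists (mpolyX K m0).
apply/seteqP; split=> f /=.
  move=> hf; apply/edge_idealE => k /msuppM[m [m' [mf m'X ->]]].
  move: m'X; rewrite msuppX inE => /eqP->.
  have [v vD mv] := weight_gt0 (hf m mf).
  have [w vw wD] := minD v vD.
  apply: matchable_le (matchable1 vw) => z; rewrite exponentD exponent_mono !inE.
  case: (eqVneq z v) => [->|_] /=; first by rewrite (leq_trans mv) ?leq_addr.
  by case: (eqVneq z w) => [->|_] //=; rewrite wD leq_addl.
move/edge_idealE => hf m mf; have : mnm_add m0 m \in msupp (f * mpolyX K m0).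
  by rewrite (perm_mem (msuppMX _ _)) map_f.
move/hf/(matchableS sG)=> [x [y [xy xym _]]].
have [z zD zxy] : exists2 z, z \in D & z \in [set x; y]%SET.
  have /orP[xD|yD] := vertex_coverP _ _ cD _ _ xy.
    by exists x; rewrite ?inE ?eqxx.
  by exists y; rewrite ?inE ?eqxx ?orbT.
have := xym z; rewrite zxy exponentD exponent_mono zD /= add0n => mz.
by rewrite (weightD1 _ zD) (leq_trans mz) ?leq_addr.
Qed.

(** Localised at the prime of a minimal cover D, elements of I^s keep weight at
    least s along D, since denominators have a monomial of weight zero. *)
Lemma symbolic_pow_weight s f C : vertex_cover G C ->
  symbolic_pow (edge_ideal K G) s f -> supported (fun m => s <= weight (exponent m) C)%N f.
Proof.
move=> cC /= sf.
have [D [cD DC] minD] := minimal_vertex_cover sG cC.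
have [p [u [ps uD fE]]] := sf _ (hits_associated cD minD).
have u0 : u != 0.
  by apply/eqP => u0; apply: uD; rewrite u0; case: (hits_prime D) => [[]].
have tu0 : tofrac u != 0 by rewrite tofrac_eq0.
have pE : f * u = p.
  by apply/eqP; rewrite -tofrac_eq tofracM fE mulfVK.
suff sDf : supported (fun m => s <= weight (exponent m) D)%N f.
  by move=> m /sDf h; apply: leq_trans h (weightS _ DC).
apply: (@supported_div _ _ _ _ u) (not_hits uD) _ => [m1 m2|].
  exact: weight_exponentD.
rewrite mulrC pE => m /((edge_ideal_powE _ _).1 ps).
exact: matchable_weight.
Qed.

Lemma prime_monomial (P : set (mpoly #|V| K)) m : prime_ideal P ->
  (forall v, (0 < exponent m v)%N -> ~ P (vertex_var K v)) -> ~ P (mpolyX K m).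
Proof.
move=> [_ P1 PM] hm; rewrite mpolyXE_id.
apply: (big_ind (fun f => ~ P f)) => // [f g Pf Pg /PM[]//|i _].
have := hm (enum_val i); rewrite /vertex_var /exponent enum_valK.
case: (m i) => [|k] /=; first by rewrite expr0.
move=> /(_ isT) Pi; elim: k => [|k IH]; first by rewrite expr1.
by rewrite exprS => /PM[].
Qed.

(** Associated primes come from minimal covers.  Write P = (I : g) and let m be a
    monomial of g outside I.  If x_v is in P then x_v m is in I, so m contains a
    neighbour w of v.  As x_w divides m and I is squarefree, x_w m is not
    in I. *)
Lemma associated_prime_nbr (P : set (mpoly #|V| K)) v :
    associated_prime (edge_ideal K G) P -> P (vertex_var K v) ->
  exists2 w, adj G v w & ~ P (vertex_var K w).
Proof.
move=> [[_ P1 _] [g Pg]] Pv.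
have [m mg mNI] : exists2 m, m \in msupp g & ~ monomial_matchable 1 m.
  apply: contrapT => nex; apply: P1; rewrite Pg /= mul1r; apply/edge_idealE => m mg.
  by apply: contrapT => mNI; apply: nex; exists m.
have P_edge w : P (vertex_var K w) -> exists x y, [/\ adj G x y,
    forall z, (z \in [set x; y]%SET <= (w == z) + exponent m z)%N & w \in [set x; y]%SET].
  rewrite Pg /= mulrC => /edge_idealE/(_ (mnm_add (mnm1 (enum_rank w)) m)).
  rewrite (perm_mem (msuppMX _ _)) map_f // => /(_ isT).
  case/(matchableS sG)=> x [y [xy xym _]].
  exists x, y; split=> // [z|]; first by have := xym z; rewrite exponentD exponent1.
  apply: contrapT => wxy; apply: mNI; apply: matchable_le (matchable1 xy) => z.
  have := xym z; rewrite exponentD exponent1.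
  by case: (eqVneq w z) => [<-|//]; move/negP/negPf: wxy => ->.
have [w vw mw] : exists2 w, adj G v w & (0 < exponent m w)%N.
  have [x [y [xy xym]]] := P_edge v Pv.
  have xNy := adj_neq sG xy.
  rewrite in_set2 => /orP[] /eqP ev; subst v.
    by exists y => //; have := xym y; rewrite !inE eqxx orbT (negPf xNy).
  exists x; first by rewrite adjC.
  by have := xym x; rewrite !inE eqxx /= eq_sym (negPf xNy).
exists w => // /P_edge[x [y [xy xym wxy]]]; apply: mNI.
apply: matchable_le (matchable1 xy) => z; have := xym z.
by case: (eqVneq w z) => [<- _|//]; apply: leq_trans (leq_b1 _) mw.
Qed.

Lemma associated_prime_cover (P : set (mpoly #|V| K)) :
    associated_prime (edge_ideal K G) P ->
  vertex_cover G [set v | `[< P (vertex_var K v) >]]%SET.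
Proof.
move=> [[_ _ PM] [g Pg]]; apply/vertex_coverP => x y xy; rewrite !inE.
have [Px|Py] : P (vertex_var K x) \/ P (vertex_var K y); last 2 first.
- by apply/orP; left; apply/asboolP.
- by apply/orP; right; apply/asboolP.
apply: PM; rewrite Pg /= mulrC.
by have [_ _] := edge_ideal_ideal; apply; apply: edge_ideal_edge.
Qed.

(** Let C be the cover of the variables in the associated prime P, and choose for
    each v in C a neighbour nb v outside C.  Multiplying x^a by the product of
    the x_(nb v)^(a v), which is not in P, completes all these vertices to edges,
    as many as the weight of C. *)
Lemma symbolic_pow_monomial s a :
    (forall C, vertex_cover G C -> s <= weight a C)%N ->
  symbolic_pow (edge_ideal K G) s (mpolyX K (mono a)).
Proof.
move=> sa P aP; have := aP; move=> [[idP P1 PM] _].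
pose C := [set v | `[< P (vertex_var K v) >]]%SET.
have cC : vertex_cover G C := associated_prime_cover aP.
have inC v : (v \in C) = `[< P (vertex_var K v) >] by rewrite inE.
have /choice[nb nbP] : forall v, exists w, v \in C -> adj G v w /\ w \notin C.
  move=> v; case: (boolP (v \in C)) => vC; last by exists v.
  have /asboolP Pv : `[< P (vertex_var K v) >] by rewrite -inC.
  have [w vw Pw] := associated_prime_nbr aP Pv.
  by exists w => _; split=> //; rewrite inC; apply/asboolPn.
pose b w := weight (fun v => a v * (nb v == w))%N C.
exists (mpolyX K (mono a) * mpolyX K (mono b)), (mpolyX K (mono b)); split.
- apply/edge_ideal_powE => m; rewrite -mpolyXD -monoD msuppX inE => /eqP->.
  rewrite /monomial_matchable exponent_mono; apply: matchable_leq (sa C cC) _.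
  have edges_out v : v \in C ->
      matchable G (a v) (fun w => a v * (w \in [set v; nb v]%SET))%N.
    by case/nbP=> vnb _; apply/matchable_mul/matchable1.
  apply: matchable_le (matchable_sum edges_out) => w.
  have aw : (\sum_(v in C) a v * (v == w) <= a w)%N.
    rewrite big_mkcond (bigD1 w) //= eqxx muln1 big1 ?addn0 => [|v /negPf->].
      by case: ifP.
    by rewrite muln0 if_same.
  apply: leq_trans (leq_add aw (leqnn (b w))); rewrite /b /weight -big_split.
  apply: leq_sum => v _ /=; rewrite -mulnDr leq_mul2l !inE ![w == _]eq_sym.
  by case: (v == w); case: (nb v == w); rewrite ?orbT.
- apply: prime_monomial => [|w]; first by case: aP.
  rewrite exponent_mono => /weight_gt0[v vC].
  case: eqP => [<- _|_]; last by rewrite muln0.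
  by have [_] := nbP v vC; rewrite inC => /asboolPn.
by rewrite tofracM mulfK // tofrac_eq0 -msupp_eq0 msuppX.
Qed.

Lemma symbolic_pow_subset s t :
    (forall a, (forall C, vertex_cover G C -> s <= weight a C)%N -> matchable G t a) ->
  (symbolic_pow (edge_ideal K G) s `<=` ideal_pow (edge_ideal K G) t)%classic.
Proof.
move=> st f sf; apply/edge_ideal_powE => m mf; apply: st => C cC.
exact: symbolic_pow_weight sf m mf.
Qed.

Lemma symbolic_pow_not_subset s t a :
    (forall C, vertex_cover G C -> s <= weight a C)%N -> ~ matchable G t a ->
  ~ (symbolic_pow (edge_ideal K G) s `<=` ideal_pow (edge_ideal K G) t)%classic.
Proof.
move=> sa nta /(_ _ (symbolic_pow_monomial sa)) /edge_ideal_powE/(_ (mono a)).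
by rewrite msuppX mem_head /monomial_matchable exponent_mono => /(_ isT).
Qed.

End EdgeIdeal.

(** * Distant odd cycles and the two resurgences *)

Section Final.
Import mathcomp.boot.fintype mathcomp.boot.finset.
Import Order.TTheory GRing.Theory Num.Theory.
Local Open Scope ring_scope.
Variables (R : realType) (V : finType) (G : graph V).
Hypothesis sG : simple_graph G.

Lemma far_subgraph_dist (H1 H2 : graph V) :
    odd_cycle_in G H2 ->
  (2%:R%:E <= subgraph_dist R G H1 H2)%E = far G (vertices H1) (vertices H2).
Proof.
move=> oH2; apply/idP/idP => [d2|farH].
  apply: contraT => /farPn[x [y [x1 y2 xy]]].
  have : (subgraph_dist R G H1 H2 <= 1%:R%:E)%E.
    apply: le_trans (ereal_inf_lbound (_ : _ (dist R G x y))) _.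
      by exists (x, y).
    apply: ereal_inf_lbound; exists [:: y] => //=; split=> //.
      by rewrite xy.
    by rewrite inE (adj_neq sG xy).
  by move/(le_trans d2); rewrite lee_fin ler_nat.
apply: le_ereal_inf_tmp => _ [[x y] /= [x1 y2] <-].
apply: le_ereal_inf_tmp => _ [p [px _ yE] <-].
rewrite lee_fin ler_nat; case: p px yE => [|z [|? ?]] //=.
  move=> _ xy; subst y; exfalso; apply: (far_disjoint _ farH x1 y2).
  by exists H2.
rewrite andbT => xz zy; subst y.
have /negP[] : ~~ far G (vertices H1) (vertices H2) by apply/farPn; exists x, z.
exact: farH.
Qed.

Lemma far_family_size (k : nat) (L : seq {set V}) :
    max_distant_odd_cycles R G k ->
    (forall X, X \in L -> odd_cycle_set G X) -> pairwise (far G) L ->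
  (size L <= k)%N.
Proof.
move=> [_ maxk] oL pL.
have /choice[C CP] : forall i : 'I_(size L), exists H,
    odd_cycle_in G H /\ vertices H = nth finset.set0 L i.
  move=> i; have [H oH eH] := oL _ (mem_nth finset.set0 (ltn_ord i)).
  by exists H.
apply: (maxk _ C); split=> [i|i j ij]; first by case: (CP i).
have [oi ei] := CP i; have [oj ej] := CP j.
rewrite far_subgraph_dist // ei ej.
have [lt|lt|/val_inj e] := ltngtP i j; last by rewrite e eqxx in ij.
  by move/(pairwiseP finset.set0): pL; apply; rewrite ?inE.
by rewrite far_sym; move/(pairwiseP finset.set0): pL; apply; rewrite ?inE.
Qed.

Lemma distant_odd_cycles_far k (C : 'I_k -> graph V) :
  distant_odd_cycles R G C -> exists L : seq {set V},
    [/\ size L = k, forall X, X \in L -> odd_cycle_set G X &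
        pairwise (far G) L].
Proof.
move=> [oC dC]; exists [seq vertices (C i) | i <- enum 'I_k]; split.
- by rewrite size_map size_enum_ord.
- by move=> _ /mapP[i _ ->]; exists (C i).
have := enum_uniq 'I_k; rewrite uniq_pairwise pairwise_map.
apply: sub_pairwise => i j /= ij.
by rewrite -far_subgraph_dist // dC.
Qed.

Lemma ratio_le (s t p q : nat) : (0 < t)%N -> (0 < q)%N ->
  ((s%:R / t%:R : R) <= p%:R / q%:R) = (s * q <= t * p)%N.
Proof.
move=> t0 q0; rewrite ler_pdivrMr ?ltr0n // mulrAC ler_pdivlMr ?ltr0n //.
by rewrite -!natrM ler_nat [(p * t)%N]mulnC.
Qed.

(** The monomial of X raised to the power 2q: its covers have weight at least
    2q (n + 1), but its degree 2q (2n + 1) only leaves room for q (2n + 1)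
    edges. *)
Lemma odd_cycle_power_not_subset (K : fieldType) n (X : {set V}) q s t :
    odd_cycle_set G X -> #|X| = (2 * n + 1)%N -> (s <= q * (2 * n + 2))%N -> (q * (2 * n + 1) < t)%N ->
  ~ (symbolic_pow (edge_ideal K G) s `<=`
       ideal_pow (edge_ideal K G) t)%classic.
Proof.
move=> oX zX sq qt; pose L := nseq (2 * q) X.
have oL Y : Y \in L -> odd_cycle_set G Y by case/nseqP => ->.
have [vL szL] : value L = (2 * q * (n + 1))%N /\
    (\sum_(Y <- L) #|Y| = 2 * q * (2 * n + 1))%N.
  by rewrite -(size_nseq (2 * q) X); apply: value_odd_cycles_eq => Y /nseqP[->].
apply: (@symbolic_pow_not_subset _ _ _ sG _ _ (load L)) => // [C cC|mt].
  apply: leq_trans (cover_load_odd_cycles sG oL cC).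
  by rewrite vL (leq_trans sq) //; lia.
have := matchable_size sG mt; rewrite leqNgt => /negP[].
have -> : (\sum_v load L v = \sum_(v in [set: V]%SET) load L v)%N.
  by rewrite [RHS]big_mkcond; apply: eq_bigr => v _; rewrite in_setT.
rewrite sum_load (eq_bigr (fun Y : {set V} => #|Y|)) => [|Y _]; last by rewrite setIT.
by rewrite szL -mulnA ltn_pmul2l.
Qed.

Theorem asymptotic_resurgence_edge_ideal (K : fieldType) n :
    (forall a, packable G a) -> smallest_odd_cycle_size G (2 * n + 1) ->
  asymptotic_resurgence R (edge_ideal K G) =
    ((2 * n + 2)%N%:R / (2 * n + 1)%N%:R)%:E.
Proof.
move=> pG [[H oH zH] minH].
have n1 : (0 < 2 * n + 1)%N by rewrite addn1.
have oX : odd_cycle_set G (vertices H) by exists H.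
apply/eqP; rewrite eq_le; apply/andP; split.
  apply: ge_ereal_sup => _ [s [t [s0 t0 [N _ nsub] ->]]].
  rewrite lee_fin ratio_le // leqNgt; apply/negP => st.
  pose r := maxn N (#|V| * (n + 1)).
  apply: (nsub r) => /=; first exact: leq_maxl.
  apply: symbolic_pow_subset => // a.
  apply: matchable_asymptotic st (leq_maxr _ _) => //.
  by move=> _ [H' oH' <-]; apply: minH.
rewrite leNgt; apply/negP => lt.
(* These ratios are in the set for all N and tend to the bound. *)
have in_sup N : (0 < N)%N ->
    ((((2 * n + 2) * N)%:R / ((2 * n + 1) * N + 1)%:R : R)%:E <=
     asymptotic_resurgence R (edge_ideal K G))%E.
  move=> N0; apply: ereal_sup_ubound.
  exists ((2 * n + 2) * N)%N, ((2 * n + 1) * N + 1)%N.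
  split=> //; [by rewrite muln_gt0 N0 addn2|by rewrite addn1|].
  exists 1%N => // r /= r1.
  by apply: (odd_cycle_power_not_subset (q := (N * r)%N) oX zH); nia.
have := in_sup 1%N isT; move: in_sup lt.
case: (asymptotic_resurgence R (edge_ideal K G)) => [z||] // in_sup.
rewrite lte_fin => lt _.
have d0 : 0 < (2 * n + 2)%:R - z * (2 * n + 1)%:R.
  by rewrite subr_gt0 -ltr_pdivlMr ?ltr0n.
pose N := (Num.bound `|z / ((2 * n + 2)%:R - z * (2 * n + 1)%:R)|).+1.
have := in_sup N isT; rewrite lee_fin ler_pdivrMr; last by rewrite ltr0n addn1.
rewrite leNgt => /negP; apply.
rewrite natrD !natrM mulrDr mulr1 -ltrBrDl mulrA -mulrBl mulrC -ltr_pdivrMr //.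
apply: (le_lt_trans (ler_norm _)).
apply: (lt_trans (archi_boundP (normr_ge0 _))).
by rewrite ltr_nat.
Qed.

Theorem resurgence_edge_ideal (K : fieldType) n k :
    (forall a, packable G a) ->
    (forall X, odd_cycle_set G X -> #|X| = (2 * n + 1)%N) ->
    max_distant_odd_cycles R G k -> (2 <= k)%N ->
  resurgence R (edge_ideal K G) = ((k * n + k)%N%:R / (k * n + 1)%N%:R)%:E.
Proof.
move=> pG zG maxk k2.
apply/eqP; rewrite eq_le; apply/andP; split.
  apply: ge_ereal_sup => _ [s [t [s0 t0 nsub ->]]].
  have kn1 : (0 < k * n + 1)%N by rewrite addn1.
  rewrite lee_fin ratio_le // leqNgt; apply/negP => st; apply: nsub.
  apply: symbolic_pow_subset => // a.
  by apply: (matchable_equal_cycles (n := n) (k := k)) => // L; apply: far_family_size.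
have [[C /distant_odd_cycles_far[L [szL oL pL]]] _] := maxk.
have zL X : X \in L -> #|X| = (2 * n + 1)%N by move/oL/zG.
apply: ereal_sup_ubound; exists (k * n + k)%N, (k * n + 1)%N; split=> //.
- by rewrite addn_gt0 orbC; case: (k) k2.
- by rewrite addn1.
apply: (@symbolic_pow_not_subset _ _ _ sG _ _ (load L)) => // [D cD|].
  apply: leq_trans (cover_load_odd_cycles sG oL cD).
  by have [-> _] := value_odd_cycles_eq zL; rewrite szL mulnDr muln1.
by move/(far_matchable_size sG oL pL zL); rewrite szL addn1 ltnn.
Qed.

End Final.

Theorem theorem1p4 (R : realType) (K : fieldType) (V : finType) (G : graph V)
    (n : nat)
    (hV : vertices G = [set: V]%SET)
    (hG : clique_sum (@odd_cycle_or_bipartite V) G)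
    (hn : smallest_odd_cycle_size G (2 * n + 1)%N) :
  asymptotic_resurgence R (edge_ideal K G) =
    ((2 * n + 2)%N%:R / (2 * n + 1)%N%:R)%:E
  /\
  (forall k : nat,
   (forall H H', odd_cycle_in G H -> odd_cycle_in G H' ->
      #|vertices H| = #|vertices H'|) ->
   max_distant_odd_cycles R G k ->
   (2 <= k)%N ->
   resurgence R (edge_ideal K G) = ((k * n + k)%N%:R / (k * n + 1)%N%:R)%:E).
Proof.
have sG : simple_graph G by apply: clique_sum_simple hG => H [].
have pG a : packable G a by apply: clique_sum_packable hG.
split; first exact: asymptotic_resurgence_edge_ideal.
move=> k eqG; apply: resurgence_edge_ideal => // _ [H oH <-].
by have [[H0 oH0 <-] _] := hn; apply: eqG.
Qed.
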